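(* From a proof in $\textsf{E-PA}^{\omega}$ of $\textsf{ULC}$ (the statement that if a sequence of uniformly continuous functions on $[0,1]$ converges uniformly on $[0,1]$ to another function, then the latter is also uniformly continuous on $[0,1]$), a term $t$ can be extracted such that $\textsf{E-PA}^{\omega}$ proves the following statement $\textsf{ULC}_{\textsf{ef}}(t)$: for all $f,f_n:\mathbb{R}\to\mathbb{R}$, all sequences $(g_n)$ with each $g_n$ of type $1$, and all $h^1$, $$\big[(\forall n^0)C(f_n,g_n,[0,1])\wedge D(f_n,f,h,[0,1])\big]\to C(f,t(g_{(\cdot)},h),[0,1]).$$
   Context: $C(f,g,S)$ says that $f$ is uniformly continuous on $S$ with modulus $g$: $(\forall k^0)(\forall x,y\in S)(|x-y|<\frac{1}{g(k)}\to|f(x)-f(y)|\le\frac1k)$. $D(f_n,f,h,S)$ says that $h$ is a modulus of uniform convergence for $f_n\to f$ on $S$: $(\forall k^0)(\forall x\in S)(\forall N\ge h(k))(|f_N(x)-f(x)|\le\frac1k)$ (so $h$ does not depend on the point in $S$). $\textsf{E-PA}^{\omega}$ is classical Peano arithmetic in all finite types with the axiom of extensionality. Type $0$ is the type of natural numbers, $1$ is $0\to0$, superscripts denote types. ``Term'' means closed term of this language. A real number is a sequence $q_{(\cdot)}^{1}$ of (coded) rationals with $(\forall n,i)(|q_n-q_{n+i}|<2^{-n})$. Reals $x=q_{(\cdot)}$, $y=r_{(\cdot)}$ are equal, $x=_{\mathbb{R}}y$, if $(\forall n)(|q_n-r_n|\le 2^{-n+1})$; inequalities are defined similarly. The notation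 $f:\mathbb{R}\to\mathbb{R}$ means a functional $f^{1\to1}$ with $(\forall x^1,y^1)(x=_{\mathbb{R}}y\to f(x)=_{\mathbb{R}}f(y))$. Numbers occurring as denominators, including values of moduli, are understood to be positive. *)

(* Defs.v *)
From Stdlib Require Import List.
Import ListNotations.

Set Implicit Arguments.
Unset Strict Implicit.
Unset Printing Implicit Defensive.

Inductive ty : Type :=
| tO : ty
| tArr : ty -> ty -> ty.

Declare Scope ty_scope.
Delimit Scope ty_scope with ty.
Bind Scope ty_scope with ty.
Notation "a ⇒ b" := (tArr a b) (at level 55, right associativity) : ty_scope.

Notation t1 := (tO ⇒ tO)%ty.

(** Syntax is intrinsically typed: in context [G : list ty], a variable of type
    [a] is a de Bruijn index pointing at an occurrence of [a] in [G]. *)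
Inductive var : list ty -> ty -> Type :=
| vz : forall G a, var (a :: G) a
| vs : forall G a b, var G b -> var (a :: G) b.

Arguments vz {G a}.
Arguments vs {G a b} _.

(** Combinatory presentation of the closed terms of Goedel's T; lambda
    abstraction is the defined operation [lam] below. *)
Inductive const : ty -> Type :=
| cZero : const tO
| cSucc : const (tO ⇒ tO)
| cPi : forall a b, const (a ⇒ b ⇒ a)
| cSig : forall a b c, const ((a ⇒ b ⇒ c) ⇒ (a ⇒ b) ⇒ a ⇒ c)
| cRec : forall a, const (a ⇒ (a ⇒ tO ⇒ a) ⇒ tO ⇒ a).

Inductive tm (G : list ty) : ty -> Type :=
| Var : forall a, var G a -> tm G a
| Cst : forall a, const a -> tm G a
| App : forall a b, tm G (a ⇒ b) -> tm G a -> tm G b.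

Arguments Var {G a} _.
Arguments Cst {G a} _.
Arguments App {G a b} _ _.

Definition closed_term (a : ty) : Type := tm nil a.

Declare Scope tm_scope.
Delimit Scope tm_scope with tm.
Bind Scope tm_scope with tm.
Notation "s · u" := (App s u) (at level 11, left associativity) : tm_scope.

(** Equality is primitive at type 0 only; see [eqty] for higher types. *)
Inductive fm (G : list ty) : Type :=
| Eq0 : tm G tO -> tm G tO -> fm G
| Bot : fm G
| And : fm G -> fm G -> fm G
| Or : fm G -> fm G -> fm G
| Imp : fm G -> fm G -> fm G
| All : forall a, fm (a :: G) -> fm G
| Ex : forall a, fm (a :: G) -> fm G.

Arguments Bot {G}.
Arguments All {G} a _.
Arguments Ex {G} a _.

Definition sentence : Type := fm nil.

Declare Scope fm_scope.
Delimit Scope fm_scope with fm.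
Bind Scope fm_scope with fm sentence.
Notation "s =0 u" := (Eq0 s u) (at level 70, no associativity) : fm_scope.
Notation "p ∧ q" := (And p q) (at level 80, right associativity) : fm_scope.
Notation "p ∨ q" := (Or p q) (at level 85, right associativity) : fm_scope.
Notation "p ⟶ q" := (Imp p q) (at level 90, right associativity) : fm_scope.
Notation "'∀[' a ] p" := (All a p) (at level 95, p at level 95, right associativity) : fm_scope.
Notation "'∃[' a ] p" := (Ex a p) (at level 95, p at level 95, right associativity) : fm_scope.

Definition Neg {G} (p : fm G) : fm G := Imp p Bot.

Definition ren (G D : list ty) : Type := forall a, var G a -> var D a.
Definition sub (G D : list ty) : Type := forall a, var G a -> tm D a.

Fixpoint tren {G D} (r : ren G D) {a} (t : tm G a) : tm D a :=
  match t with
  | Var x => Var (r _ x)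
  | Cst c => Cst c
  | App s u => App (tren r s) (tren r u)
  end.

Fixpoint tsub {G D} (s : sub G D) {a} (t : tm G a) : tm D a :=
  match t with
  | Var x => s _ x
  | Cst c => Cst c
  | App u v => App (tsub s u) (tsub s v)
  end.

Definition scons {G D} {a} (t : tm D a) (s : sub G D) : sub (a :: G) D :=
  fun b x =>
    match x in var G' b'
      return match G' with
             | nil => unit
             | a' :: G'' => tm D a' -> sub G'' D -> tm D b'
             end with
    | vz => fun t _ => t
    | vs y => fun _ s => s _ y
    end t s.

Definition shift {G a} : ren G (a :: G) := fun _ x => vs x.
Definition wk {G a b} (t : tm G b) : tm (a :: G) b := tren shift t.

Definition up {G D a} (s : sub G D) : sub (a :: G) (a :: D) :=
  scons (Var vz) (fun b x => wk (s b x)).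

Fixpoint fsub {G D} (s : sub G D) (p : fm G) : fm D :=
  match p with
  | Eq0 u v => Eq0 (tsub s u) (tsub s v)
  | Bot => Bot
  | And p q => And (fsub s p) (fsub s q)
  | Or p q => Or (fsub s p) (fsub s q)
  | Imp p q => Imp (fsub s p) (fsub s q)
  | All a p => All a (fsub (up s) p)
  | Ex a p => Ex a (fsub (up s) p)
  end.

Definition fwk {G a} (p : fm G) : fm (a :: G) := fsub (fun _ x => Var (vs x)) p.

(** [finst p t] is p(t), where the variable of index 0 is replaced. *)
Definition finst {G a} (p : fm (a :: G)) (t : tm G a) : fm G :=
  fsub (scons t (fun _ x => Var x)) p.

(** [fsucc p] is p(S x), still in the variable x of index 0. *)
Definition fsucc {G} (p : fm (tO :: G)) : fm (tO :: G) :=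
  fsub (scons (Cst cSucc · Var vz)%tm (fun _ x => Var (vs x))) p.

Notation "↑ t" := (wk t) (at level 9, t at level 9, right associativity) : tm_scope.
Notation "#0" := (Var vz) : tm_scope.
Notation "#1" := (Var (vs vz)) : tm_scope.
Notation "#2" := (Var (vs (vs vz))) : tm_scope.
Notation "#3" := (Var (vs (vs (vs vz)))) : tm_scope.

(** Equality at higher types is an abbreviation: pointwise, down to type 0. *)

Fixpoint eqty {G} (a : ty) : tm G a -> tm G a -> fm G :=
  match a return tm G a -> tm G a -> fm G with
  | tO => fun s u => Eq0 s u
  | tArr b c => fun s u => All b (eqty (a := c) (↑s · #0)%tm (↑u · #0)%tm)
  end.

(** E-PA^omega, in natural deduction: classical many-sorted logic ([d_hyp] to
    [d_lem]), equality at type 0, extensionality, the defining equations of the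
    constants, the successor axioms and induction for all formulas.  In
    [derivation H p] the free variables of [H] and [p] are those of the context
    [G]. *)
Inductive derivation : forall G : list ty, list (fm G) -> fm G -> Type :=
| d_hyp : forall G (H : list (fm G)) p, In p H -> derivation H p
| d_botE : forall G (H : list (fm G)) p, derivation H Bot -> derivation H p
| d_andI : forall G (H : list (fm G)) p q,
    derivation H p -> derivation H q -> derivation H (And p q)
| d_andE1 : forall G (H : list (fm G)) p q, derivation H (And p q) -> derivation H p
| d_andE2 : forall G (H : list (fm G)) p q, derivation H (And p q) -> derivation H q
| d_orI1 : forall G (H : list (fm G)) p q, derivation H p -> derivation H (Or p q)
| d_orI2 : forall G (H : list (fm G)) p q, derivation H q -> derivation H (Or p q)
| d_orE : forall G (H : list (fm G)) p q r,
    derivation H (Or p q) -> derivation (p :: H) r -> derivation (q :: H) r ->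
    derivation H r
| d_impI : forall G (H : list (fm G)) p q, derivation (p :: H) q -> derivation H (Imp p q)
| d_impE : forall G (H : list (fm G)) p q,
    derivation H (Imp p q) -> derivation H p -> derivation H q
| d_allI : forall G (H : list (fm G)) a (p : fm (a :: G)),
    derivation (map fwk H) p -> derivation H (All a p)
| d_allE : forall G (H : list (fm G)) a (p : fm (a :: G)) t,
    derivation H (All a p) -> derivation H (finst p t)
| d_exI : forall G (H : list (fm G)) a (p : fm (a :: G)) t,
    derivation H (finst p t) -> derivation H (Ex a p)
| d_exE : forall G (H : list (fm G)) a (p : fm (a :: G)) q,
    derivation H (Ex a p) -> derivation (p :: map fwk H) (fwk q) -> derivation H q
| d_lem : forall G (H : list (fm G)) p, derivation H (Or p (Neg p))
| d_refl : forall G (H : list (fm G)) (s : tm G tO), derivation H (s =0 s)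
| d_sym : forall G (H : list (fm G)) (s u : tm G tO),
    derivation H ((s =0 u) ⟶ (u =0 s))
| d_trans : forall G (H : list (fm G)) (s u v : tm G tO),
    derivation H ((s =0 u) ⟶ (u =0 v) ⟶ (s =0 v))
| d_ext : forall G (H : list (fm G)) a b (z : tm G (a ⇒ b)) (s u : tm G a),
    derivation H (eqty s u ⟶ eqty (z · s) (z · u))
| d_Pi : forall G (H : list (fm G)) a b (s : tm G a) (u : tm G b),
    derivation H (eqty (Cst (cPi a b) · s · u) s)
| d_Sig : forall G (H : list (fm G)) a b c
    (s : tm G (a ⇒ b ⇒ c)) (u : tm G (a ⇒ b)) (v : tm G a),
    derivation H (eqty (Cst (cSig a b c) · s · u · v) (s · v · (u · v)))
| d_Rec0 : forall G (H : list (fm G)) a (y : tm G a) (z : tm G (a ⇒ tO ⇒ a)),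
    derivation H (eqty (Cst (cRec a) · y · z · Cst cZero) y)
| d_RecS : forall G (H : list (fm G)) a (y : tm G a) (z : tm G (a ⇒ tO ⇒ a)) (n : tm G tO),
    derivation H (eqty (Cst (cRec a) · y · z · (Cst cSucc · n))
                       (z · (Cst (cRec a) · y · z · n) · n))
| d_Sinj : forall G (H : list (fm G)) (s u : tm G tO),
    derivation H ((Cst cSucc · s =0 Cst cSucc · u) ⟶ (s =0 u))
| d_S0 : forall G (H : list (fm G)) (s : tm G tO),
    derivation H (Neg (Cst cSucc · s =0 Cst cZero))
| d_ind : forall G (H : list (fm G)) (p : fm (tO :: G)),
    derivation H (finst p (Cst cZero) ⟶ (∀[tO] (p ⟶ fsucc p)) ⟶ ∀[tO] p).

Definition proof_of (p : sentence) : Type := derivation nil p.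
Definition provable (p : sentence) : Prop := inhabited (proof_of p).

(** Lambda abstraction, by bracket abstraction. *)
Definition lam_var {G a b} (x : var (a :: G) b) : tm G (a ⇒ b) :=
  match x in var G' b'
    return match G' with nil => unit | a' :: G'' => tm G'' (a' ⇒ b') end with
  | @vz G a => Cst (cSig a (a ⇒ a) a) · Cst (cPi a (a ⇒ a)) · Cst (cPi a a)
  | vs y => Cst (cPi _ _) · Var y
  end.

Fixpoint lam {G a b} (t : tm (a :: G) b) : tm G (a ⇒ b) :=
  match t with
  | Var x => lam_var x
  | Cst c => Cst (cPi _ _) · Cst c
  | App s u => Cst (cSig _ _ _) · lam s · lam u
  end.

Definition zero {G} : tm G tO := Cst cZero.
Definition succ {G} (n : tm G tO) : tm G tO := (Cst cSucc · n)%tm.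
Definition one {G} : tm G tO := succ zero.
Definition two {G} : tm G tO := succ one.

(** [recur y z n]: in [z], index 1 is the previous value and index 0 the
    recursion argument. *)
Definition recur {G a} (y : tm G a) (z : tm (tO :: a :: G) a) (n : tm G tO) : tm G a :=
  (Cst (cRec a) · y · lam (lam z) · n)%tm.

Definition add {G} (m n : tm G tO) : tm G tO := recur m (succ #1) n.
Definition mul {G} (m n : tm G tO) : tm G tO := recur zero (add #1 ↑↑m) n.
Definition pred {G} (n : tm G tO) : tm G tO := recur zero #0 n.
Definition monus {G} (m n : tm G tO) : tm G tO := recur m (pred #1) n.
Definition pow2 {G} (n : tm G tO) : tm G tO := recur one (add #1 #1) n.
(** [ifz n s u] is [s] if n = 0 and [u] otherwise. *)
Definition ifz {G} (n s u : tm G tO) : tm G tO := recur s ↑↑u n.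

Definition le {G} (m n : tm G tO) : fm G := ∃[tO] (add ↑m #0 =0 ↑n).
Definition lt {G} (m n : tm G tO) : fm G := le (succ m) n.

(** Cantor pairing (m + n)(m + n + 1)/2 + n. *)
Definition tri {G} (n : tm G tO) : tm G tO := recur zero (add #1 (succ #0)) n.
Definition pair {G} (m n : tm G tO) : tm G tO := add (tri (add m n)) n.

(** [unpair k] is a function with value the first component of [k] at 0 and the
    second at 1.  It walks along the diagonals: (0, b) is followed by (b+1, 0),
    and (a+1, b) by (a, b+1). *)
Definition unpair {G} (k : tm G tO) : tm G t1 :=
  recur (Cst (cPi _ _) · zero)
    (let p := #1%tm in
     let a := (p · zero)%tm in
     let b := (p · one)%tm in
     lam (ifz ↑a (ifz #0 (succ ↑b) zero)
                 (ifz #0 (pred ↑a) (succ ↑b)))) k.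
Definition fst {G} (k : tm G tO) : tm G tO := (unpair k · zero)%tm.
Definition snd {G} (k : tm G tO) : tm G tO := (unpair k · one)%tm.

(** The number <<a, b>, c> codes the rational (a - b)/(c + 1). *)
Definition qcode {G} (a b c : tm G tO) : tm G tO := pair (pair a b) c.
Definition qpos {G} (q : tm G tO) : tm G tO := fst (fst q).
Definition qneg {G} (q : tm G tO) : tm G tO := snd (fst q).
Definition qden {G} (q : tm G tO) : tm G tO := succ (snd q).

(** a/d, for positive d *)
Definition qfrac {G} (a d : tm G tO) : tm G tO := qcode a zero (pred d).

Definition qadd {G} (q r : tm G tO) : tm G tO :=
  qcode (add (mul (qpos q) (qden r)) (mul (qpos r) (qden q)))
        (add (mul (qneg q) (qden r)) (mul (qneg r) (qden q)))
        (pred (mul (qden q) (qden r))).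
Definition qopp {G} (q : tm G tO) : tm G tO := qcode (qneg q) (qpos q) (snd q).
Definition qsub {G} (q r : tm G tO) : tm G tO := qadd q (qopp r).
Definition qabs {G} (q : tm G tO) : tm G tO :=
  qcode (add (monus (qpos q) (qneg q)) (monus (qneg q) (qpos q))) zero (snd q).

Definition qle {G} (q r : tm G tO) : fm G :=
  le (add (mul (qpos q) (qden r)) (mul (qneg r) (qden q)))
     (add (mul (qpos r) (qden q)) (mul (qneg q) (qden r))).
Definition qlt {G} (q r : tm G tO) : fm G :=
  lt (add (mul (qpos q) (qden r)) (mul (qneg r) (qden q)))
     (add (mul (qpos r) (qden q)) (mul (qneg q) (qden r))).

(** 2^(-n) and 2^(-n+1) *)
Definition eps {G} (n : tm G tO) : tm G tO := qfrac one (pow2 n).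
Definition eps2 {G} (n : tm G tO) : tm G tO := qfrac two (pow2 n).

Definition is_real {G} (x : tm G t1) : fm G :=
  ∀[tO] ∀[tO] qlt (qabs (qsub (↑↑x · #1) (↑↑x · add #1 #0))) (eps #1).

Definition req {G} (x y : tm G t1) : fm G :=
  ∀[tO] qle (qabs (qsub (↑x · #0) (↑y · #0))) (eps2 #0).
Definition rle {G} (x y : tm G t1) : fm G :=
  ∀[tO] qle (↑x · #0) (qadd (↑y · #0) (eps2 #0)).
Definition rlt {G} (x y : tm G t1) : fm G :=
  ∃[tO] qlt (qadd (↑x · #0) (eps2 #0)) (↑y · #0).

Definition rconst {G} (q : tm G tO) : tm G t1 := (Cst (cPi tO tO) · q)%tm.
(** The index is shifted so that the difference again has modulus 2^(-n). *)
Definition rsub {G} (x y : tm G t1) : tm G t1 :=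
  lam (qsub (↑x · succ #0) (↑y · succ #0)).
Definition rabs {G} (x : tm G t1) : tm G t1 := lam (qabs (↑x · #0)).
Definition rdist {G} (x y : tm G t1) : tm G t1 := rabs (rsub x y).
Definition rinv {G} (k : tm G tO) : tm G t1 := rconst (qfrac one k).

(** A subset of R, given by its membership formula. *)
Definition rset : Type := forall G, tm G t1 -> fm G.
Definition unit_interval : rset := fun G x =>
  (is_real x ∧ rle (rconst (qfrac zero one)) x ∧ rle x (rconst (qfrac one one)))%fm.

(** f : R -> R, i.e. f maps reals to reals and respects equality of reals. *)
Definition is_fun {G} (f : tm G (t1 ⇒ t1)) : fm G :=
  (∀[t1] (is_real #0 ⟶ is_real (↑f · #0))) ∧
  (∀[t1] ∀[t1] (is_real #1 ⟶ is_real #0 ⟶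
     req #1 #0 ⟶ req (↑↑f · #1) (↑↑f · #0))).

(** |x - y| < 1/m implies |f(x) - f(y)| <= 1/k, for all x, y in S. *)
Definition cont_within {G} (f : tm G (t1 ⇒ t1)) (m k : tm G tO) (S : rset) : fm G :=
  ∀[t1] ∀[t1] (S _ #1%tm ⟶ S _ #0%tm ⟶
    rlt (rdist #1 #0) (rinv ↑↑m) ⟶
    rle (rdist (↑↑f · #1) (↑↑f · #0)) (rinv ↑↑k)).

(** |f_N(x) - f(x)| <= 1/k for all x in S and N >= m. *)
Definition conv_within {G} (fs : tm G (tO ⇒ t1 ⇒ t1)) (f : tm G (t1 ⇒ t1))
    (m k : tm G tO) (S : rset) : fm G :=
  ∀[t1] (S _ #0%tm ⟶ ∀[tO] (le ↑↑m #0 ⟶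
    rle (rdist (↑↑fs · #0 · #1) (↑↑f · #1)) (rinv ↑↑k))).

(** The denominators k and g(k) are positive: k by restriction of the
    quantifier, g(k) as part of what it means to be a modulus. *)
Definition C {G} (f : tm G (t1 ⇒ t1)) (g : tm G t1) (S : rset) : fm G :=
  ∀[tO] (lt zero #0 ⟶ lt zero (↑g · #0) ∧ cont_within ↑f (↑g · #0) #0 S).

Definition D {G} (fs : tm G (tO ⇒ t1 ⇒ t1)) (f : tm G (t1 ⇒ t1)) (h : tm G t1)
    (S : rset) : fm G :=
  ∀[tO] (lt zero #0 ⟶ conv_within ↑fs ↑f (↑h · #0) #0 S).

Definition unif_cont {G} (f : tm G (t1 ⇒ t1)) (S : rset) : fm G :=
  ∀[tO] (lt zero #0 ⟶ ∃[tO] (lt zero #0 ∧ cont_within ↑↑f #0 #1 S)).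

Definition unif_conv {G} (fs : tm G (tO ⇒ t1 ⇒ t1)) (f : tm G (t1 ⇒ t1))
    (S : rset) : fm G :=
  ∀[tO] (lt zero #0 ⟶ ∃[tO] conv_within ↑↑fs ↑↑f #0 #1 S).

(** In scope: f (index 1), (f_n) (index 0). *)
Definition ULC : sentence :=
  ∀[t1 ⇒ t1] ∀[tO ⇒ t1 ⇒ t1]
    (is_fun #1 ⟶
     (∀[tO] is_fun (#1 · #0)) ⟶
     (∀[tO] unif_cont (#1 · #0) unit_interval) ∧ unif_conv #0 #1 unit_interval ⟶
     unif_cont #1 unit_interval).

(** In scope: f (index 3), (f_n) (index 2), (g_n) (index 1), h (index 0). *)
Definition ULC_ef (t : closed_term ((tO ⇒ t1) ⇒ t1 ⇒ t1)) : sentence :=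
  ∀[t1 ⇒ t1] ∀[tO ⇒ t1 ⇒ t1] ∀[tO ⇒ t1] ∀[t1]
    (is_fun #3 ⟶
     (∀[tO] is_fun (#3 · #0)) ⟶
     (∀[tO] C (#3 · #0) (#2 · #0) unit_interval) ∧ D #2 #3 #0 unit_interval ⟶
     C #3 (↑↑↑↑t · #1 · #0) unit_interval).

(* Main.v *)
From Stdlib Require Import List Setoid Morphisms Ring.
Require Import Defs.
Import ListNotations.

Set Implicit Arguments.
Unset Strict Implicit.
Unset Printing Implicit Defensive.

(** A modulus for the limit can be written down. Given k, put K = 3 k and
    N = h(K), and let |x - y| < 1/g_N(K). Then each step from f(x) to
    f_N(x) to f_N(y) to f(y) is at most 1/K, so that f(x) and f(y) are within
    3/K = 1/k. Hence t(g, h)(k) = g(h(3 k))(3 k), which is the term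
    [modulus]; the rest is the derivation of this argument inside E-PA^omega.

    An inequality |a - b| <= 1/K between reals says that their approximations
    satisfy |a_(n+1) - b_(n+1)| <= 1/K + 2 / 2^n for every n, so adding three of them
    yields 6 / 2^n where only 2 / 2^n is allowed. The remedy is to add them at a
    later index: passing from index n + 1 to n + 4 in f(x) and in f(y) costs
    2 / 2^(n+1), and at the later index the three errors sum to 6 / 2^(n+3).
    The total is below 2 / 2^n ([error_sum]), so a fixed finite computation with
    rationals suffices and no limit has to be taken ([dist_chain]).

    Derivations are handled through the relation [H ⊢ p]. Lemmas are schematic in
    the terms that they mention, which replaces most quantifiers of the object
    theory by quantifiers over terms; provable equality [s ≡[H] u] is a
    congruence, so the rewriting tactics apply to it. The numbers form
    a semiring up to provable equality ([semiring]), and m <= n is an equation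
    m + z = n with an explicit term z ([le_iff]); together these reduce the
    arithmetic of coded rationals to polynomial identities. That the components
    of a pair code can be recovered is proved by walking along the diagonals
    ([diagonal_walk], [diagonal_start]).

    The delicate point is substitution. Abstraction is defined by bracket
    abstraction, and a substitution instance of an abstraction is in general only
    provably equal, not identical, to an abstraction ([is_ren], [tsub_lam]). For
    operations on terms this is repaired by rewriting with provable equalities.
    For the formulas about functions and moduli it is avoided: they are
    instantiated at variables only, after the numbers K and N have been named by
    fresh variables ([name_number]). *)

(** * Substitution *)

(** Case analysis on a variable of a nonempty context, with a motive that does not
    mention the shape of the context. *)
Lemma var_case G a (P : forall b, var (a :: G) b -> Prop) :
  P a vz -> (forall b (y : var G b), P b (vs y)) -> forall b x, P b x.
Proof.
  intros Hz Hs b x.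
  refine (match x as x' in var G' b' return
    match G' return var G' b' -> Prop with
    | nil => fun _ => True
    | a' :: G'' => fun x' => forall P : forall b, var (a' :: G'') b -> Prop,
        P a' vz -> (forall b (y : var G'' b), P b (vs y)) -> P b' x'
    end x' with vz => _ | vs y => _ end P Hz Hs); auto.
Qed.

Lemma tsub_ext G D (s s' : sub G D) a (t : tm G a) :
  (forall b x, s b x = s' b x) -> tsub s t = tsub s' t.
Proof. intros E; induction t; simpl; congruence. Qed.

Lemma tren_tsub G D (r : ren G D) a (t : tm G a) :
  tren r t = tsub (fun _ x => Var (r _ x)) t.
Proof. induction t; simpl; congruence. Qed.

Lemma tsub_tsub G D E (s : sub G D) (s' : sub D E) a (t : tm G a) :
  tsub s' (tsub s t) = tsub (fun _ x => tsub s' (s _ x)) t.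
Proof. induction t; simpl; congruence. Qed.

Lemma tsub_var G a (t : tm G a) : tsub (fun _ x => Var x) t = t.
Proof. induction t; simpl; congruence. Qed.

Lemma tsub_wk G D a b (s : sub (a :: G) D) (t : tm G b) :
  tsub s (wk t) = tsub (fun _ x => s _ (vs x)) t.
Proof. unfold wk; rewrite tren_tsub; apply tsub_tsub. Qed.

Lemma tsub_scons_wk G D a b (u : tm D a) (s : sub G D) (t : tm G b) :
  tsub (scons u s) (wk t) = tsub s t.
Proof. apply tsub_wk. Qed.

Lemma wk_tsub G D a b (s : sub G D) (t : tm G b) :
  wk (a := a) (tsub s t) = tsub (fun _ x => wk (s _ x)) t.
Proof.
  unfold wk at 1. rewrite tren_tsub, tsub_tsub. apply tsub_ext; intros c x.
  symmetry; apply tren_tsub.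
Qed.

Lemma tsub_up_wk G D a b (s : sub G D) (t : tm G b) :
  tsub (up (a := a) s) (wk t) = wk (tsub s t).
Proof. rewrite tsub_wk, wk_tsub. reflexivity. Qed.

Lemma tsub_shift G a b (t : tm G b) :
  tsub (fun _ x => Var (vs x)) t = wk (a := a) t.
Proof. symmetry; apply tren_tsub. Qed.

Lemma tsub_scons_shift G a b (t : tm (a :: G) b) :
  tsub (scons #0 (fun _ x => Var (vs x))) t = t.
Proof.
  transitivity (tsub (fun _ x => Var x) t); [|apply tsub_var].
  apply tsub_ext, var_case; reflexivity.
Qed.

Lemma fsub_eqty G D (s : sub G D) a (u v : tm G a) :
  fsub s (eqty u v) = eqty (tsub s u) (tsub s v).
Proof.
  revert G D s u v; induction a as [|b _ c IH]; intros; simpl; [reflexivity|].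
  rewrite IH; simpl. now rewrite !tsub_up_wk.
Qed.

#[local] Create HintDb ren.

(** Bracket abstraction commutes with a substitution only if the latter maps
    variables to variables: [lam] of a variable that does not occur is
    [cPi · x], whereas [lam] of a compound term is an instance of [cSig]. *)
Definition is_ren G D (s : sub G D) : Prop :=
  forall a x, exists y : var D a, s a x = Var y.

Lemma is_ren_shift G a : is_ren (fun b (x : var G b) => Var (vs (a := a) x)).
Proof. intros b x; eauto. Qed.

Lemma is_ren_scons G a (y : var G a) : is_ren (scons (Var y) (fun _ x => Var x)).
Proof.
  unfold is_ren; apply (var_case (P := fun b x => exists y0, scons _ _ x = Var y0));
  simpl; eauto.
Qed.

Lemma is_ren_up G D a (s : sub G D) : is_ren s -> is_ren (up (a := a) s).
Proof.
  intros R; unfold is_ren;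
  apply (var_case (P := fun b x => exists y0, up s x = Var y0)); [simpl; eauto|].
  intros b y; simpl. destruct (R b y) as [z ->]. exists (vs z); reflexivity.
Qed.

#[local] Hint Resolve is_ren_up is_ren_shift is_ren_scons : ren.

Lemma tsub_lam_ren G D (s : sub G D) a b (t : tm (a :: G) b) :
  is_ren s -> tsub s (lam t) = lam (tsub (up s) t).
Proof.
  intros R; induction t as [b x| |]; simpl.
  - revert b x; apply (var_case (P := fun b x => tsub s (lam_var x) = lam (up s x)));
      [reflexivity|].
    intros b y; simpl. destruct (R b y) as [z ->]. reflexivity.
  - reflexivity.
  - now rewrite IHt1, IHt2.
Qed.

(** * Entailment and provable equality *)

Definition entails G (H : list (fm G)) (p : fm G) : Prop := inhabited (derivation H p).
#[local] Notation "H ⊢ p" := (entails H p%fm) (at level 96, no associativity).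

Section Rules.
Context G (H : list (fm G)).
Implicit Types p q r : fm G.

Lemma hyp p : In p H -> H ⊢ p.
Proof. intros; constructor; now apply d_hyp. Qed.
Lemma and_intro p q : (H ⊢ p) -> (H ⊢ q) -> H ⊢ p ∧ q.
Proof. intros [?] [?]; constructor; now apply d_andI. Qed.
Lemma and_left p q : (H ⊢ p ∧ q) -> H ⊢ p.
Proof. intros [?]; constructor; eapply d_andE1; eassumption. Qed.
Lemma and_right p q : (H ⊢ p ∧ q) -> H ⊢ q.
Proof. intros [?]; constructor; eapply d_andE2; eassumption. Qed.
Lemma or_left p q : (H ⊢ p) -> H ⊢ p ∨ q.
Proof. intros [?]; constructor; now apply d_orI1. Qed.
Lemma or_right p q : (H ⊢ q) -> H ⊢ p ∨ q.
Proof. intros [?]; constructor; now apply d_orI2. Qed.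
Lemma or_elim p q r : (H ⊢ p ∨ q) -> (p :: H ⊢ r) -> (q :: H ⊢ r) -> H ⊢ r.
Proof. intros [?] [?] [?]; constructor; eapply d_orE; eassumption. Qed.
Lemma imp_intro p q : (p :: H ⊢ q) -> H ⊢ p ⟶ q.
Proof. intros [?]; constructor; now apply d_impI. Qed.
Lemma imp_elim p q : (H ⊢ p ⟶ q) -> (H ⊢ p) -> H ⊢ q.
Proof. intros [?] [?]; constructor; eapply d_impE; eassumption. Qed.
Lemma all_intro a (p : fm (a :: G)) : (map fwk H ⊢ p) -> H ⊢ ∀[a] p.
Proof. intros [?]; constructor; now apply d_allI. Qed.
Lemma all_elim a (p : fm (a :: G)) t : (H ⊢ ∀[a] p) -> H ⊢ finst p t.
Proof. intros [?]; constructor; now apply d_allE. Qed.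
Lemma ex_intro_at a (p : fm (a :: G)) t : (H ⊢ finst p t) -> H ⊢ ∃[a] p.
Proof. intros [?]; constructor; now apply d_exI with t. Qed.
Lemma ex_elim a (p : fm (a :: G)) q :
  (H ⊢ ∃[a] p) -> (p :: map fwk H ⊢ fwk q) -> H ⊢ q.
Proof. intros [?] [?]; constructor; eapply d_exE; eassumption. Qed.
End Rules.

Lemma induction_rule G (H : list (fm G)) (p : fm (tO :: G)) n :
  (H ⊢ finst p zero) ->
  (p :: map fwk H ⊢ fsub (scons (succ #0) (fun _ x => Var (vs x))) p) -> H ⊢ finst p n.
Proof.
  intros H0 HS. apply all_elim. eapply imp_elim; [eapply imp_elim|].
  - constructor; apply d_ind.
  - exact H0.
  - now apply all_intro, imp_intro.
Qed.

Lemma weaken G (H H' : list (fm G)) p : incl H H' -> (H ⊢ p) -> H' ⊢ p.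
Proof.
  intros I [d]; constructor. revert H' I.
  induction d; intros H' I; try (econstructor; eauto; fail).
  - eapply d_orE; [eauto | apply IHd2 | apply IHd3];
      (apply incl_cons; [now left | now apply incl_tl]).
  - apply d_impI, IHd. apply incl_cons; [now left | now apply incl_tl].
  - apply d_allI, IHd; now apply incl_map.
  - eapply d_exE; [eauto | apply IHd2].
    apply incl_cons; [now left|]. now apply incl_tl, incl_map.
Qed.

Lemma weaken1 G (H : list (fm G)) p q : (H ⊢ p) -> q :: H ⊢ p.
Proof. apply weaken; intros ? ?; now right. Qed.

(** This takes the place of closure of derivability under renaming of variables:
    facts about [H] are first made into formulas of a list [Hs]. *)
Lemma cut_all G (Hs H : list (fm G)) p :
  (Hs ⊢ p) -> Forall (entails H) Hs -> H ⊢ p.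
Proof.
  revert p; induction Hs as [|q Hs IH]; intros p Hp F.
  - eapply weaken; [|exact Hp]; intros ? [].
  - apply Forall_cons_iff in F as [Hq F].
    apply (@imp_elim _ _ q); [apply IH; [now apply imp_intro | exact F] | exact Hq].
Qed.

(** [by_hyp] proves a formula that is listed in the context, possibly only up to
    computation. *)
Ltac by_hyp :=
  apply hyp; match goal with |- In _ ?L => try unfold L end; simpl; auto 10.

(** [name_context H] abbreviates the context of the goal, which keeps rewriting
    from inspecting it. *)
Tactic Notation "name_context" ident(H) :=
  match goal with |- ?L ⊢ _ => set (H := L) end.

(** [restrict_to Hs] replaces the context by formulas [Hs] that are known to
    hold in it. Afterwards a shift under a quantifier acts on explicitly given
    formulas only. *)
Ltac restrict_to Hs :=
  apply (@cut_all _ Hs);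
  [clear | repeat apply Forall_cons; try apply Forall_nil; assumption].

Definition eqv {G} (H : list (fm G)) {a} (s u : tm G a) : Prop := H ⊢ eqty s u.
#[local] Notation "s ≡[ H ] u" := (eqv H s%tm u%tm) (at level 70, no associativity).

Lemma eqv_ext G (H : list (fm G)) a b (s u : tm G (a ⇒ b)) :
  (↑s · #0 ≡[map fwk H] ↑u · #0) -> s ≡[H] u.
Proof. apply all_intro. Qed.

Lemma eqv_app_fun G (H : list (fm G)) a b (s u : tm G (a ⇒ b)) v :
  (s ≡[H] u) -> s · v ≡[H] u · v.
Proof.
  intros E. apply (all_elim v) in E. unfold finst in E.
  rewrite fsub_eqty in E; simpl in E. now rewrite !tsub_scons_wk, !tsub_var in E.
Qed.

Lemma eqv_app_arg G (H : list (fm G)) a b (z : tm G (a ⇒ b)) s u :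
  (s ≡[H] u) -> z · s ≡[H] z · u.
Proof. intros E. eapply imp_elim; [constructor; apply d_ext | exact E]. Qed.

Lemma fwk_eqty G a b (s u : tm G b) : fwk (a := a) (eqty s u) = eqty (wk s) (wk u).
Proof. unfold fwk. rewrite fsub_eqty. now rewrite !tsub_shift. Qed.

(** Symmetry and transitivity are proved in the form of derivable implications,
    because the induction passes to contexts with more variables, where the
    premises are then available as formulas. *)
#[local] Instance eqv_equivalence G (H : list (fm G)) a : Equivalence (@eqv G H a).
Proof.
  split.
  - intros s. revert G H s; induction a as [|a _ b IH]; intros.
    + constructor; apply d_refl.
    + apply eqv_ext, IH.
  - enough (S : forall s u, H ⊢ eqty s u ⟶ eqty u s)
      by (intros s u; apply imp_elim, S).
    revert G H; induction a as [|a _ b IH]; intros.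
    + constructor; apply d_sym.
    + apply imp_intro, eqv_ext. eapply imp_elim; [apply IH|].
      apply eqv_app_fun, hyp. left. apply fwk_eqty.
  - enough (T : forall s u v, H ⊢ eqty s u ⟶ eqty u v ⟶ eqty s v)
      by (intros s u v E; apply imp_elim, (imp_elim (T s u v)), E).
    revert G H; induction a as [|a _ b IH]; intros.
    + constructor; apply d_trans.
    + apply imp_intro, imp_intro, eqv_ext.
      eapply imp_elim; [eapply imp_elim; [apply IH|]|]; apply eqv_app_fun, hyp.
      * right; left. apply fwk_eqty.
      * left. apply fwk_eqty.
Qed.

#[local] Instance App_proper G (H : list (fm G)) a b :
  Proper (eqv H ==> eqv H ==> eqv H) (@App G a b).
Proof.
  intros s s' Es u u' Eu. transitivity (s · u')%tm.
  - now apply eqv_app_arg.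
  - now apply eqv_app_fun.
Qed.

(** Interderivability in a fixed context suffices for rewriting inside atomic
    formulas. *)
Definition fequiv {G} (H : list (fm G)) (p q : fm G) : Prop := (H ⊢ p) <-> (H ⊢ q).

#[local] Instance fequiv_equivalence G (H : list (fm G)) : Equivalence (fequiv H).
Proof. unfold fequiv; split; red; intros; tauto. Qed.

#[local] Instance entails_proper G (H : list (fm G)) :
  Proper (fequiv H ==> iff) (entails H).
Proof. intros p q E; exact E. Qed.

Lemma eqv_hyp G (H : list (fm G)) s u : In (s =0 u)%fm H -> s ≡[H] u.
Proof. apply hyp. Qed.

Lemma Pi_eqv G (H : list (fm G)) a b (s : tm G a) (u : tm G b) :
  Cst (cPi a b) · s · u ≡[H] s.
Proof. constructor; apply d_Pi. Qed.
Lemma Sig_eqv G (H : list (fm G)) a b c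
    (s : tm G (a ⇒ b ⇒ c)) (u : tm G (a ⇒ b)) (v : tm G a) :
  Cst (cSig a b c) · s · u · v ≡[H] s · v · (u · v).
Proof. constructor; apply d_Sig. Qed.

Lemma tsub_eqv G D (H : list (fm D)) (s s' : sub G D) a (t : tm G a) :
  (forall b x, s b x ≡[H] s' b x) -> tsub s t ≡[H] tsub s' t.
Proof. intros E; induction t; simpl; [apply E | reflexivity | now apply App_proper]. Qed.

(** Beta conversion has to be stated for substitution instances of an
    abstraction because these are not abstractions again. *)
Lemma beta_sub G D (H : list (fm D)) (s : sub G D) a b (t : tm (a :: G) b) u :
  tsub s (lam t) · u ≡[H] tsub (scons u s) t.
Proof.
  induction t as [b x|b c|b c t IHt v IHv]; simpl.
  - revert b x. apply (var_case (P := fun b x =>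
      tsub s (lam_var x) · u ≡[H] scons u s x)); simpl.
    + now rewrite Sig_eqv, Pi_eqv.
    + intros b y. apply Pi_eqv.
  - apply Pi_eqv.
  - now rewrite Sig_eqv, IHt, IHv.
Qed.

Lemma beta G (H : list (fm G)) a b (t : tm (a :: G) b) u :
  lam t · u ≡[H] tsub (scons u (fun _ x => Var x)) t.
Proof. rewrite <- (beta_sub H). now rewrite tsub_var. Qed.

Lemma lam_eqv G (H : list (fm G)) a b (t t' : tm (a :: G) b) :
  (t ≡[map fwk H] t') -> lam t ≡[H] lam t'.
Proof.
  intros E. apply eqv_ext. unfold wk. rewrite !tren_tsub, !beta_sub.
  unfold shift. now rewrite !tsub_scons_shift.
Qed.

(** The counterpart of [tsub_lam_ren] for arbitrary substitutions; extensionality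
    turns agreement of all values into provable equality. *)
Lemma tsub_lam G D (H : list (fm D)) (s : sub G D) a b (t : tm (a :: G) b) :
  tsub s (lam t) ≡[H] lam (tsub (up s) t).
Proof.
  apply eqv_ext. rewrite wk_tsub, beta_sub. unfold wk at 2.
  rewrite tren_tsub, beta_sub, tsub_tsub. apply tsub_eqv.
  apply var_case; [reflexivity|]. intros b' y; simpl.
  rewrite tsub_scons_wk. now rewrite tsub_shift.
Qed.

(** * Arithmetic *)

#[local] Notation ids := (fun _ x => Var x).

Lemma tsub_recur G D (H : list (fm D)) (s : sub G D) a y (z : tm (tO :: a :: G) a) n :
  tsub s (recur y z n) ≡[H] recur (tsub s y) (tsub (up (up s)) z) (tsub s n).
Proof.
  unfold recur; simpl. now rewrite tsub_lam, (lam_eqv (tsub_lam _ _ _)).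
Qed.

Lemma tsub_recur_ren G D (s : sub G D) a y (z : tm (tO :: a :: G) a) n :
  is_ren s ->
  tsub s (recur y z n) = recur (tsub s y) (tsub (up (up s)) z) (tsub s n).
Proof.
  intros R; unfold recur; simpl. now rewrite !tsub_lam_ren by auto using is_ren_up.
Qed.

Lemma recur_zero G (H : list (fm G)) a y (z : tm (tO :: a :: G) a) :
  recur y z zero ≡[H] y.
Proof. constructor; apply d_Rec0. Qed.

Lemma recur_succ G (H : list (fm G)) a y (z : tm (tO :: a :: G) a) n :
  recur y z (succ n) ≡[H] tsub (scons n (scons (recur y z n) ids)) z.
Proof.
  transitivity (lam (lam z) · recur y z n · n)%tm.
  - constructor; apply d_RecS.
  - now rewrite beta, beta_sub.
Qed.

#[local] Instance recur_proper G (H : list (fm G)) a :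
  Proper (eqv H ==> eq ==> eqv H ==> eqv H) (@recur G a).
Proof. intros y y' E z _ <- n n' F. unfold recur. now rewrite E, F. Qed.

(** Operations in whose definition no argument is under an abstraction commute with
    substitution by computation; [mul], [ifz], [qadd], [qsub] and [rdist] are
    treated separately below. *)
Section Substitution.
Context G D (s : sub G D).
Implicit Types m n k : tm G tO.

Lemma tsub_app a b (u : tm G (a ⇒ b)) (v : tm G a) :
  tsub s (u · v) = (tsub s u · tsub s v)%tm.
Proof. reflexivity. Qed.
Lemma tsub_Var a (x : var G a) : tsub s (Var x) = s x.
Proof. reflexivity. Qed.
Lemma tsub_Cst a (c : const a) : tsub s (Cst c) = Cst c.
Proof. reflexivity. Qed.
Lemma tsub_zero : tsub s zero = zero. Proof. reflexivity. Qed.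
Lemma tsub_succ n : tsub s (succ n) = succ (tsub s n). Proof. reflexivity. Qed.
Lemma tsub_one : tsub s one = one. Proof. reflexivity. Qed.
Lemma tsub_two : tsub s two = two. Proof. reflexivity. Qed.
Lemma tsub_add m n : tsub s (add m n) = add (tsub s m) (tsub s n).
Proof. reflexivity. Qed.
Lemma tsub_pred n : tsub s (pred n) = pred (tsub s n). Proof. reflexivity. Qed.
Lemma tsub_monus m n : tsub s (monus m n) = monus (tsub s m) (tsub s n).
Proof. reflexivity. Qed.
Lemma tsub_pow2 n : tsub s (pow2 n) = pow2 (tsub s n). Proof. reflexivity. Qed.
Lemma tsub_tri n : tsub s (tri n) = tri (tsub s n). Proof. reflexivity. Qed.
Lemma tsub_pair m n : tsub s (pair m n) = pair (tsub s m) (tsub s n).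
Proof. reflexivity. Qed.
Lemma tsub_unpair n : tsub s (unpair n) = unpair (tsub s n). Proof. reflexivity. Qed.
Lemma tsub_fst n : tsub s (fst n) = fst (tsub s n).
Proof. unfold fst. now rewrite tsub_app, tsub_unpair. Qed.
Lemma tsub_snd n : tsub s (snd n) = snd (tsub s n).
Proof. unfold snd. now rewrite tsub_app, tsub_unpair. Qed.
Lemma tsub_qcode m n k : tsub s (qcode m n k) = qcode (tsub s m) (tsub s n) (tsub s k).
Proof. unfold qcode. now rewrite !tsub_pair. Qed.
Lemma tsub_qpos n : tsub s (qpos n) = qpos (tsub s n).
Proof. unfold qpos. now rewrite !tsub_fst. Qed.
Lemma tsub_qneg n : tsub s (qneg n) = qneg (tsub s n).
Proof. unfold qneg. now rewrite tsub_snd, tsub_fst. Qed.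
Lemma tsub_qden n : tsub s (qden n) = qden (tsub s n).
Proof. unfold qden. now rewrite tsub_succ, tsub_snd. Qed.
Lemma tsub_qfrac m n : tsub s (qfrac m n) = qfrac (tsub s m) (tsub s n).
Proof. unfold qfrac. now rewrite tsub_qcode, tsub_pred, tsub_zero. Qed.
Lemma tsub_qopp n : tsub s (qopp n) = qopp (tsub s n).
Proof. unfold qopp. now rewrite tsub_qcode, tsub_qneg, tsub_qpos, tsub_snd. Qed.
Lemma tsub_qabs n : tsub s (qabs n) = qabs (tsub s n).
Proof.
  unfold qabs.
  now rewrite tsub_qcode, tsub_add, !tsub_monus, tsub_qneg, tsub_qpos, tsub_snd, tsub_zero.
Qed.
Lemma tsub_eps n : tsub s (eps n) = eps (tsub s n).
Proof. unfold eps. now rewrite tsub_qfrac, tsub_one, tsub_pow2. Qed.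
Lemma tsub_eps2 n : tsub s (eps2 n) = eps2 (tsub s n).
Proof. unfold eps2. now rewrite tsub_qfrac, tsub_two, tsub_pow2. Qed.
Lemma tsub_rconst n : tsub s (rconst n) = rconst (tsub s n).
Proof. reflexivity. Qed.
Lemma tsub_rinv n : tsub s (rinv n) = rinv (tsub s n).
Proof. unfold rinv. now rewrite tsub_rconst, tsub_qfrac, tsub_one. Qed.
End Substitution.

Lemma scons_vz G D a (u : tm D a) (s : sub G D) : scons u s vz = u.
Proof. reflexivity. Qed.
Lemma scons_vs G D a b (u : tm D a) (s : sub G D) (x : var G b) :
  scons u s (vs x) = s b x.
Proof. reflexivity. Qed.
Lemma up_vz G D a (s : sub G D) : up s vz = Var (vz (a := a)).
Proof. reflexivity. Qed.
Lemma up_vs G D a b (s : sub G D) (x : var G b) : up (a := a) s (vs x) = wk (s b x).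
Proof. reflexivity. Qed.

Section Weakening.
Context (G : list ty) (c : ty).
Lemma wk_zero : wk (G := G) (a := c) zero = zero. Proof. reflexivity. Qed.
Lemma wk_succ (n : tm G tO) : wk (a := c) (succ n) = succ (wk n).
Proof. reflexivity. Qed.
Lemma wk_Var a (x : var G a) : wk (a := c) (Var x) = Var (vs x).
Proof. reflexivity. Qed.
Lemma wk_app a b (u : tm G (a ⇒ b)) (v : tm G a) :
  wk (a := c) (u · v) = (wk u · wk v)%tm.
Proof. reflexivity. Qed.
End Weakening.

#[local] Instance add_proper G (H : list (fm G)) :
  Proper (eqv H ==> eqv H ==> eqv H) (@add G).
Proof. intros m m' E n n' F. unfold add. now rewrite E, F. Qed.
#[local] Instance succ_proper G (H : list (fm G)) :
  Proper (eqv H ==> eqv H) (@succ G).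
Proof. intros n n' F. unfold succ. now rewrite F. Qed.
#[local] Instance pred_proper G (H : list (fm G)) :
  Proper (eqv H ==> eqv H) (@pred G).
Proof. intros n n' F. unfold pred. now rewrite F. Qed.
#[local] Instance monus_proper G (H : list (fm G)) :
  Proper (eqv H ==> eqv H ==> eqv H) (@monus G).
Proof. intros m m' E n n' F. unfold monus. now rewrite E, F. Qed.
#[local] Instance pow2_proper G (H : list (fm G)) :
  Proper (eqv H ==> eqv H) (@pow2 G).
Proof. intros n n' F. unfold pow2. now rewrite F. Qed.
#[local] Instance tri_proper G (H : list (fm G)) :
  Proper (eqv H ==> eqv H) (@tri G).
Proof. intros n n' F. unfold tri. now rewrite F. Qed.
#[local] Instance unpair_proper G (H : list (fm G)) :
  Proper (eqv H ==> eqv H) (@unpair G).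
Proof. intros n n' F. unfold unpair. now rewrite F. Qed.

Section Recursion.
Context G (H : list (fm G)).
Implicit Types m n : tm G tO.

Lemma add_zero_r m : add m zero ≡[H] m. Proof. apply recur_zero. Qed.
Lemma add_succ_r m n : add m (succ n) ≡[H] succ (add m n). Proof. apply recur_succ. Qed.
Lemma mul_zero_r m : mul m zero ≡[H] zero. Proof. apply recur_zero. Qed.
Lemma mul_succ_r m n : mul m (succ n) ≡[H] add (mul m n) m.
Proof.
  unfold mul. rewrite recur_succ, tsub_add, !tsub_scons_wk, tsub_var. reflexivity.
Qed.
Lemma pred_zero : pred zero ≡[H] zero. Proof. apply recur_zero. Qed.
Lemma pred_succ n : pred (succ n) ≡[H] n. Proof. apply recur_succ. Qed.
Lemma monus_zero_r m : monus m zero ≡[H] m. Proof. apply recur_zero. Qed.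
Lemma monus_succ_r m n : monus m (succ n) ≡[H] pred (monus m n).
Proof. apply recur_succ. Qed.
Lemma pow2_zero : pow2 zero ≡[H] one. Proof. apply recur_zero. Qed.
Lemma pow2_succ n : pow2 (succ n) ≡[H] add (pow2 n) (pow2 n).
Proof. apply recur_succ. Qed.
Lemma ifz_zero (u v : tm G tO) : ifz zero u v ≡[H] u. Proof. apply recur_zero. Qed.
Lemma ifz_succ n (u v : tm G tO) : ifz (succ n) u v ≡[H] v.
Proof.
  unfold ifz. now rewrite recur_succ, !tsub_scons_wk, tsub_var.
Qed.
Lemma tri_zero : tri zero ≡[H] zero. Proof. apply recur_zero. Qed.
Lemma tri_succ n : tri (succ n) ≡[H] add (tri n) (succ n). Proof. apply recur_succ. Qed.
Lemma one_eqv : one ≡[H] succ zero. Proof. reflexivity. Qed.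
Lemma two_eqv : two ≡[H] succ one. Proof. reflexivity. Qed.
End Recursion.

Lemma tsub_mul G D (H : list (fm D)) (s : sub G D) m n :
  tsub s (mul m n) ≡[H] mul (tsub s m) (tsub s n).
Proof.
  unfold mul. rewrite tsub_recur. now rewrite tsub_add, !tsub_up_wk.
Qed.

Lemma tsub_ifz G D (H : list (fm D)) (s : sub G D) n u v :
  tsub s (ifz n u v) ≡[H] ifz (tsub s n) (tsub s u) (tsub s v).
Proof.
  unfold ifz. rewrite tsub_recur. now rewrite !tsub_up_wk.
Qed.

Lemma tsub_mul_ren G D (s : sub G D) m n :
  is_ren s -> tsub s (mul m n) = mul (tsub s m) (tsub s n).
Proof.
  intros R. unfold mul. rewrite tsub_recur_ren by exact R.
  now rewrite tsub_add, !tsub_up_wk.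
Qed.

(** An operation whose definition abstracts over its argument respects
    provable equality because it is an instance of one fixed term. *)
#[local] Instance mul_proper G (H : list (fm G)) :
  Proper (eqv H ==> eqv H ==> eqv H) (@mul G).
Proof.
  intros m m' E n n' F.
  pose (t := mul (Var (G := tO :: tO :: G) vz) #1).
  transitivity (tsub (scons m (scons n ids)) t); [symmetry; apply tsub_mul|].
  transitivity (tsub (scons m' (scons n' ids)) t); [|apply tsub_mul].
  apply tsub_eqv, var_case; [exact E|]. apply var_case; [exact F|]. reflexivity.
Qed.

#[local] Instance ifz_proper G (H : list (fm G)) :
  Proper (eqv H ==> eqv H ==> eqv H ==> eqv H) (@ifz G).
Proof.
  intros n n' E u u' F v v' K.
  pose (t := ifz (Var (G := tO :: tO :: tO :: G) vz) #1 #2).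
  transitivity (tsub (scons n (scons u (scons v ids))) t); [symmetry; apply tsub_ifz|].
  transitivity (tsub (scons n' (scons u' (scons v' ids))) t); [|apply tsub_ifz].
  apply tsub_eqv, var_case; [exact E|]. apply var_case; [exact F|].
  apply var_case; [exact K|]. reflexivity.
Qed.

Lemma unpair_zero G (H : list (fm G)) i : unpair zero · i ≡[H] zero.
Proof. unfold unpair. now rewrite recur_zero, Pi_eqv. Qed.

(** One step along the diagonals, for both components at once: [i] is 0 or 1. *)
Lemma unpair_succ G (H : list (fm G)) k i :
  (unpair (succ k) · i)%tm ≡[H]
    ifz (fst k) (ifz i (succ (snd k)) zero) (ifz i (pred (fst k)) (succ (snd k))).
Proof.
  unfold fst, snd. unfold unpair at 1. rewrite recur_succ.
  fold (unpair k). rewrite beta_sub, tsub_ifz. rewrite !tsub_ifz.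
  rewrite tsub_zero, !tsub_succ, tsub_pred, !tsub_scons_wk. reflexivity.
Qed.

(** From here on the operations are used through their equations only. Sealing them
    also keeps unification from comparing the unfolded combinators. *)
Global Opaque zero succ one two add mul pred monus pow2 ifz tri unpair.

#[local] Hint Rewrite tsub_zero tsub_succ tsub_one tsub_two tsub_add tsub_pred tsub_monus
  tsub_pow2 tsub_tri tsub_pair tsub_unpair tsub_fst tsub_snd tsub_qcode tsub_qpos
  tsub_qneg tsub_qden tsub_qfrac tsub_qopp tsub_qabs tsub_eps tsub_eps2 tsub_rconst
  tsub_rinv @scons_vz @scons_vs @up_vz @up_vs @tsub_scons_wk @tsub_up_wk @tsub_var
  @tsub_shift wk_zero wk_succ wk_Var wk_app @tsub_app @tsub_Var @tsub_Cst : subst.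
#[local] Hint Rewrite tsub_mul tsub_ifz : subst.

Lemma eqv_ind G (H : list (fm G)) (l r : tm (tO :: G) tO) n :
  (tsub (scons zero ids) l ≡[H] tsub (scons zero ids) r) ->
  (forall H', (l ≡[H'] r) ->
     tsub (scons (succ #0) (fun _ x => Var (vs x))) l
       ≡[H'] tsub (scons (succ #0) (fun _ x => Var (vs x))) r) ->
  tsub (scons n ids) l ≡[H] tsub (scons n ids) r.
Proof.
  intros E0 ES. apply (induction_rule (p := (l =0 r)%fm)); [exact E0|].
  apply ES, hyp. now left.
Qed.

(** [induct n for l ≡ r] proves the goal [l(n) ≡ r(n)] by induction on the
    variable [#0] of [l] and [r]. *)
Tactic Notation "induct" constr(n) "for" uconstr(l) "≡" uconstr(r) :=
  lazymatch goal with |- @eqv ?G ?H _ _ _ =>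
    let E := fresh in
    assert (E : tsub (scons n ids) (l : tm (tO :: G) tO) ≡[H]
                tsub (scons n ids) (r : tm (tO :: G) tO));
    [apply eqv_ind;
      [|let H := fresh "H" in let IH := fresh "IH" in intros H IH];
      autorewrite with subst
    |autorewrite with subst in E; exact E]
  end.

Local Open Scope tm_scope.

Lemma add_zero_l G (H : list (fm G)) (n : tm G tO) : add zero n ≡[H] n.
Proof.
  induct n for (add zero #0) ≡ #0.
  - apply add_zero_r.
  - now rewrite add_succ_r, IH.
Qed.

Lemma add_succ_l G (H : list (fm G)) (m n : tm G tO) :
  add (succ m) n ≡[H] succ (add m n).
Proof.
  induct n for (add (succ ↑m) #0) ≡ (succ (add ↑m #0)).
  - now rewrite !add_zero_r.
  - now rewrite !add_succ_r, IH.
Qed.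

Lemma add_comm G (H : list (fm G)) (m n : tm G tO) : add m n ≡[H] add n m.
Proof.
  induct n for (add ↑m #0) ≡ (add #0 ↑m).
  - now rewrite add_zero_r, add_zero_l.
  - now rewrite add_succ_r, add_succ_l, IH.
Qed.

Lemma add_assoc G (H : list (fm G)) (m n k : tm G tO) :
  add m (add n k) ≡[H] add (add m n) k.
Proof.
  induct k for (add ↑m (add ↑n #0)) ≡ (add (add ↑m ↑n) #0).
  - now rewrite !add_zero_r.
  - now rewrite !add_succ_r, IH.
Qed.

Lemma mul_zero_l G (H : list (fm G)) (n : tm G tO) : mul zero n ≡[H] zero.
Proof.
  induct n for (mul zero #0) ≡ zero.
  - apply mul_zero_r.
  - now rewrite mul_succ_r, IH, add_zero_r.
Qed.

Lemma mul_succ_l G (H : list (fm G)) (m n : tm G tO) :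
  mul (succ m) n ≡[H] add (mul m n) n.
Proof.
  induct n for (mul (succ ↑m) #0) ≡ (add (mul ↑m #0) #0).
  - now rewrite !mul_zero_r, add_zero_r.
  - rewrite !mul_succ_r, IH, !add_succ_r.
    now rewrite <- !add_assoc, (add_comm _ ↑m).
Qed.

Lemma mul_comm G (H : list (fm G)) (m n : tm G tO) : mul m n ≡[H] mul n m.
Proof.
  induct n for (mul ↑m #0) ≡ (mul #0 ↑m).
  - now rewrite mul_zero_r, mul_zero_l.
  - now rewrite mul_succ_r, mul_succ_l, IH.
Qed.

Lemma mul_add_distr_r G (H : list (fm G)) (m n k : tm G tO) :
  mul (add m n) k ≡[H] add (mul m k) (mul n k).
Proof.
  induct k for (mul (add ↑m ↑n) #0) ≡ (add (mul ↑m #0) (mul ↑n #0)).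
  - now rewrite !mul_zero_r, add_zero_r.
  - rewrite !mul_succ_r, IH, <- !add_assoc.
    now rewrite (add_assoc _ ↑m), (add_comm _ ↑m (mul _ _)), <- add_assoc.
Qed.

Lemma mul_assoc G (H : list (fm G)) (m n k : tm G tO) :
  mul m (mul n k) ≡[H] mul (mul m n) k.
Proof.
  induct k for (mul ↑m (mul ↑n #0)) ≡ (mul (mul ↑m ↑n) #0).
  - now rewrite !mul_zero_r.
  - rewrite !mul_succ_r, <- IH.
    rewrite (mul_comm _ ↑m (add _ _)), mul_add_distr_r.
    now rewrite (mul_comm _ (mul _ _) ↑m), (mul_comm _ ↑n ↑m).
Qed.

Lemma mul_one_l G (H : list (fm G)) (n : tm G tO) : mul one n ≡[H] n.
Proof. now rewrite one_eqv, mul_succ_l, mul_zero_l, add_zero_l. Qed.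

Lemma semiring G (H : list (fm G)) : semi_ring_theory zero one (@add G) (@mul G) (eqv H).
Proof.
  constructor; auto using add_zero_l, add_comm, add_assoc, mul_one_l, mul_zero_l,
    mul_comm, mul_assoc, mul_add_distr_r.
Qed.

Lemma semiring_ext G (H : list (fm G)) : sring_eq_ext (@add G) (@mul G) (eqv H).
Proof. constructor; [apply add_proper | apply mul_proper]. Qed.


Lemma succ_add G (H : list (fm G)) n : succ n ≡[H] add n one.
Proof. now rewrite one_eqv, add_succ_r, add_zero_r. Qed.

(** * Order *)

Lemma monus_succ_succ G (H : list (fm G)) m n :
  monus (succ m) (succ n) ≡[H] monus m n.
Proof.
  induct n for (monus (succ ↑m) (succ #0)) ≡ (monus ↑m #0).
  - now rewrite monus_succ_r, !monus_zero_r, pred_succ.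
  - now rewrite monus_succ_r, IH, monus_succ_r.
Qed.

Lemma add_monus G (H : list (fm G)) m n : monus (add n m) n ≡[H] m.
Proof.
  induct n for (monus (add #0 ↑m) #0) ≡ (↑m).
  - now rewrite add_zero_l, monus_zero_r.
  - now rewrite add_succ_l, monus_succ_succ, IH.
Qed.

Lemma monus_zero_l G (H : list (fm G)) n : monus zero n ≡[H] zero.
Proof.
  induct n for (monus zero #0) ≡ zero.
  - apply monus_zero_r.
  - now rewrite monus_succ_r, IH, pred_zero.
Qed.

Lemma monus_add G (H : list (fm G)) m n : monus m (add m n) ≡[H] zero.
Proof.
  induct m for (monus #0 (add #0 ↑n)) ≡ zero.
  - apply monus_zero_l.
  - now rewrite add_succ_l, monus_succ_succ, IH.
Qed.

Lemma add_cancel_l G (H : list (fm G)) k m n :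
  (add k m ≡[H] add k n) -> m ≡[H] n.
Proof. intros E. now rewrite <- (add_monus H m k), E, add_monus. Qed.

Lemma add_eq_zero_r G (H : list (fm G)) m n : (add m n ≡[H] zero) -> n ≡[H] zero.
Proof. intros E. now rewrite <- (add_monus H n m), E, monus_zero_l. Qed.

Lemma fsub_le G D (s : sub G D) m n : fsub s (le m n) = le (tsub s m) (tsub s n).
Proof. unfold le; simpl. now rewrite tsub_add, !tsub_up_wk. Qed.

Lemma fsub_lt G D (s : sub G D) m n : fsub s (lt m n) = lt (tsub s m) (tsub s n).
Proof. unfold lt. now rewrite fsub_le, tsub_succ. Qed.

Lemma le_monus G (H : list (fm G)) m n : (H ⊢ le m n) -> add m (monus n m) ≡[H] n.
Proof.
  intros L. apply (ex_elim L). rewrite fwk_eqty.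
  rewrite <- (tsub_shift _ (add m _)), tsub_add, tsub_monus, !tsub_shift.
  name_context H'.
  assert (E : add ↑m #0 ≡[H'] ↑n) by (apply eqv_hyp; now left).
  change (add ↑m (monus ↑n ↑m) ≡[H'] ↑n).
  now rewrite <- E, add_monus.
Qed.

(** An order relation amounts to an equation, with [monus n m] as the witness,
    so that no eigenvariables are needed to reason about it. *)
Lemma le_iff G (H : list (fm G)) m n :
  (H ⊢ le m n) <-> exists z, add m z ≡[H] n.
Proof.
  split.
  - intros L. exists (monus n m). now apply le_monus.
  - intros [z E]. apply (ex_intro_at (t := z)). unfold finst; simpl.
    rewrite tsub_add, !tsub_scons_wk, !tsub_var. exact E.
Qed.

#[local] Instance le_proper G (H : list (fm G)) :
  Proper (eqv H ==> eqv H ==> fequiv H) (@le G).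
Proof.
  intros m m' E n n' F. unfold fequiv. rewrite !le_iff.
  setoid_rewrite E. now setoid_rewrite F.
Qed.

#[local] Instance lt_proper G (H : list (fm G)) :
  Proper (eqv H ==> eqv H ==> fequiv H) (@lt G).
Proof. intros m m' E n n' F. unfold lt. now rewrite E, F. Qed.

Global Opaque le.

Lemma zero_or_succ G (H : list (fm G)) n : H ⊢ (n =0 zero) ∨ (n =0 succ (pred n)).
Proof.
  assert (E : H ⊢ finst ((#0 =0 zero) ∨ (#0 =0 succ (pred #0))) n).
  { apply induction_rule; unfold finst; simpl.
    - apply or_left, (eqv_equivalence H tO).
    - apply or_right. autorewrite with subst.
      name_context H'.
      change (succ #0 ≡[H'] succ (pred (succ #0))).
      now rewrite pred_succ. }
  unfold finst in E; simpl in E. now autorewrite with subst in E.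
Qed.

Lemma le_total G (H : list (fm G)) m n : H ⊢ le m n ∨ le n m.
Proof.
  assert (E : H ⊢ finst (le #0 ↑n ∨ le ↑n #0) m).
  { apply induction_rule; unfold finst; simpl; rewrite !fsub_le;
      autorewrite with subst.
    - apply or_left, le_iff. exists n. apply add_zero_l.
    - eapply or_elim; [apply hyp; now left| |].
      + name_context H'.
        assert (L : H' ⊢ le #0 ↑n) by (apply hyp; now left).
        apply le_iff in L as [z L].
        eapply or_elim; [apply (zero_or_succ H' z)| |];
          name_context H2;
          assert (L2 : add #0 z ≡[H2] ↑n) by now apply weaken1.
        * assert (Z : z ≡[H2] zero) by (apply eqv_hyp; now left).
          apply or_right, le_iff. exists one.
          now rewrite <- L2, Z, add_zero_r, succ_add.
        * assert (Z : z ≡[H2] succ (pred z)) by (apply eqv_hyp; now left).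
          apply or_left, le_iff. exists (pred z).
          now rewrite <- L2, Z, pred_succ, add_succ_l, add_succ_r.
      + name_context H'.
        assert (L : H' ⊢ le ↑n #0) by (apply hyp; now left).
        apply le_iff in L as [z L].
        apply or_right, le_iff. exists (succ z).
        now rewrite add_succ_r, L. }
  unfold finst in E; simpl in E. rewrite !fsub_le in E.
  now autorewrite with subst in E.
Qed.

Definition absdiff G (m n : tm G tO) : tm G tO := add (monus m n) (monus n m).

#[local] Instance absdiff_proper G (H : list (fm G)) :
  Proper (eqv H ==> eqv H ==> eqv H) (@absdiff G).
Proof. intros m m' E n n' F. unfold absdiff. now rewrite E, F. Qed.

Lemma absdiff_sym G (H : list (fm G)) m n : absdiff m n ≡[H] absdiff n m.
Proof. apply add_comm. Qed.

Lemma absdiff_add G (H : list (fm G)) m z : absdiff m (add m z) ≡[H] z.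
Proof. unfold absdiff. now rewrite monus_add, add_monus, add_zero_l. Qed.

Section Inequalities.
Context G (H : list (fm G)).
Implicit Types m n k u v x y z d t w : tm G tO.

Add Ring inequalities_ring : (semiring H)
  (setoid (eqv_equivalence H tO) (semiring_ext H)).

(** The two cases of [le_total], with the order relation in each case already
    turned into an equation. *)
Lemma le_total_cases m n p :
  (forall H' z, incl H H' -> (add m z ≡[H'] n) -> H' ⊢ p) ->
  (forall H' z, incl H H' -> (add n z ≡[H'] m) -> H' ⊢ p) -> H ⊢ p.
Proof.
  intros C1 C2.
  apply (or_elim (le_total H m n)); [eapply C1 | eapply C2];
    try (now apply incl_tl, incl_refl); apply le_monus, hyp; now left.
Qed.

(** If m = n + z, the hypothesis becomes w + z (d + 1) = 0, so that z = 0. *)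
Lemma le_cancel_of_ge m n d t w z :
  (add (add (mul m (succ d)) t) w ≡[H] add (mul n (succ d)) t) ->
  (add n z ≡[H] m) -> H ⊢ le m n.
Proof.
  intros E F. rewrite <- F in E.
  assert (E' : add (add (mul n (succ d)) t) (add (add w (mul z d)) z)
               ≡[H] add (add (mul n (succ d)) t) zero).
  { rewrite add_zero_r. etransitivity; [|exact E]. rewrite !succ_add. ring. }
  apply add_cancel_l, add_eq_zero_r in E'.
  rewrite E', add_zero_r in F. apply le_iff. exists zero. now rewrite add_zero_r.
Qed.

Lemma absdiff_le_of_le x y d u v z :
  (add x z ≡[H] y) ->
  (H ⊢ le (add (mul y d) u) (add v (mul x d))) ->
  H ⊢ le (add (mul (absdiff x y) d) u) v.
Proof.
  rewrite !le_iff. intros F [w E]. exists w. rewrite <- F in E |- *.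
  rewrite absdiff_add. apply (add_cancel_l (k := mul x d)).
  rewrite (add_comm H (mul x d) v), <- E. ring.
Qed.

Lemma le_absdiff_of_le x y d u v z :
  (add x z ≡[H] y) ->
  (H ⊢ le (add (mul (absdiff x y) d) u) v) ->
  (H ⊢ le (add (mul y d) u) (add v (mul x d)))
  /\ (H ⊢ le (add (mul x d) u) (add v (mul y d))).
Proof.
  rewrite !le_iff. intros F [w E]. rewrite <- F, absdiff_add in E.
  split; [exists w|exists (add w (add (mul z d) (mul z d)))]; rewrite <- F, <- E; ring.
Qed.
End Inequalities.

(** Inequalities between fractions follow after multiplication by further
    denominators and addition of common terms; this undoes both. *)
Lemma le_cancel G (H : list (fm G)) m n d t w :
  (add (add (mul m (succ d)) t) w ≡[H] add (mul n (succ d)) t) -> H ⊢ le m n.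
Proof.
  intros E. apply (le_total_cases (H := H) (m := m) (n := n)); intros H' z I F.
  - apply le_iff; eauto.
  - eapply le_cancel_of_ge; [eapply weaken; [exact I | exact E] | exact F].
Qed.

(** The shape is that of [qle] with an absolute value on the left: with a common
    denominator, |x - y| <= r amounts to x <= r + y and y <= r + x. *)
Lemma absdiff_le G (H : list (fm G)) x y d u v :
  (H ⊢ le (add (mul (absdiff x y) d) u) v) <->
  (H ⊢ le (add (mul x d) u) (add v (mul y d))) /\
  (H ⊢ le (add (mul y d) u) (add v (mul x d))).
Proof.
  split.
  - intros L; split;
    apply (le_total_cases (H := H) (m := x) (n := y)); intros H' z I F;
    apply (weaken I) in L.
    + now apply (le_absdiff_of_le F L).
    + setoid_rewrite absdiff_sym in L. now apply (le_absdiff_of_le F L).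
    + now apply (le_absdiff_of_le F L).
    + setoid_rewrite absdiff_sym in L. now apply (le_absdiff_of_le F L).
  - intros [L M]. apply (le_total_cases (H := H) (m := x) (n := y)); intros H' z I F.
    + apply (absdiff_le_of_le F), (weaken I M).
    + setoid_rewrite absdiff_sym. apply (absdiff_le_of_le F), (weaken I L).
Qed.

(** * Pairing *)

#[local] Instance fst_proper G (H : list (fm G)) : Proper (eqv H ==> eqv H) (@fst G).
Proof. intros n n' E. unfold fst. now rewrite E. Qed.
#[local] Instance snd_proper G (H : list (fm G)) : Proper (eqv H ==> eqv H) (@snd G).
Proof. intros n n' E. unfold snd. now rewrite E. Qed.
#[local] Instance pair_proper G (H : list (fm G)) :
  Proper (eqv H ==> eqv H ==> eqv H) (@pair G).
Proof. intros m m' E n n' F. unfold pair. now rewrite E, F. Qed.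

Lemma fst_zero G (H : list (fm G)) : fst zero ≡[H] zero.
Proof. unfold fst. now rewrite unpair_zero. Qed.
Lemma snd_zero G (H : list (fm G)) : snd zero ≡[H] zero.
Proof. unfold snd. now rewrite unpair_zero. Qed.

Section Steps.
Context G (H : list (fm G)) (k a : tm G tO).

Lemma fst_succ_of_zero : (fst k ≡[H] zero) -> fst (succ k) ≡[H] succ (snd k).
Proof. intros E. unfold fst at 1. now rewrite unpair_succ, E, !ifz_zero. Qed.
Lemma snd_succ_of_zero : (fst k ≡[H] zero) -> snd (succ k) ≡[H] zero.
Proof. intros E. unfold snd at 1. now rewrite unpair_succ, E, ifz_zero, one_eqv, ifz_succ. Qed.
Lemma fst_succ_of_succ : (fst k ≡[H] succ a) -> fst (succ k) ≡[H] a.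
Proof.
  intros E. unfold fst at 1. now rewrite unpair_succ, E, ifz_succ, ifz_zero, pred_succ.
Qed.
Lemma snd_succ_of_succ : (fst k ≡[H] succ a) -> snd (succ k) ≡[H] succ (snd k).
Proof. intros E. unfold snd at 1. now rewrite unpair_succ, E, one_eqv, !ifz_succ. Qed.
End Steps.

Global Opaque fst snd.

(** The pair on diagonal [d] with second component [n] is [(m, n)]. *)
Definition on_diagonal G (d m n : tm G tO) : fm G :=
  (fst (add (tri d) n) =0 m ∧ snd (add (tri d) n) =0 n)%fm.

Lemma fsub_on_diagonal G D (s : sub G D) d m n :
  fsub s (on_diagonal d m n) = on_diagonal (tsub s d) (tsub s m) (tsub s n).
Proof. unfold on_diagonal; simpl. now autorewrite with subst. Qed.

Lemma on_diagonal_iff G (H : list (fm G)) d m n :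
  (H ⊢ on_diagonal d m n) <->
  (fst (add (tri d) n) ≡[H] m) /\ (snd (add (tri d) n) ≡[H] n).
Proof.
  split.
  - intros L. split; [exact (and_left L) | exact (and_right L)].
  - intros []. now apply and_intro.
Qed.

#[local] Instance on_diagonal_proper G (H : list (fm G)) :
  Proper (eqv H ==> eqv H ==> eqv H ==> fequiv H) (@on_diagonal G).
Proof.
  intros d d' E m m' F n n' K. unfold fequiv. rewrite !on_diagonal_iff.
  now rewrite E, F, K.
Qed.

Global Opaque on_diagonal.

Lemma on_diagonal_step G (H : list (fm G)) d m n :
  (H ⊢ on_diagonal d (succ m) n) -> H ⊢ on_diagonal d m (succ n).
Proof.
  rewrite !on_diagonal_iff. intros [E F]. rewrite !add_succ_r. split.
  - exact (fst_succ_of_succ E).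
  - now rewrite (snd_succ_of_succ E), F.
Qed.

(** Induction on n, with m universally quantified in the induction formula: the
    point (m, n + 1) is reached from (m + 1, n), and both lie on the diagonal
    m + n + 1. *)
Lemma diagonal_walk G (H : list (fm G)) m n :
  (H ⊢ on_diagonal (add m n) (add m n) zero) -> H ⊢ on_diagonal (add m n) m n.
Proof.
  pose (p := (∀[tO] (on_diagonal (add #0 #1) (add #0 #1) zero ⟶
                     on_diagonal (add #0 #1) #0 #1))%fm : fm (tO :: G)).
  assert (E : H ⊢ finst p n).
  { apply induction_rule; unfold p, finst; simpl;
      rewrite !fsub_on_diagonal; autorewrite with subst.
    - apply all_intro, imp_intro.
      name_context H'.
      assert (E : H' ⊢ on_diagonal (add #0 zero) (add #0 zero) zero)
        by (apply hyp; now left).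
      now rewrite !add_zero_r in E |- *.
    - apply all_intro, imp_intro.
      name_context H'.
      assert (E : H' ⊢ fwk p) by (apply hyp; right; now left).
      apply (all_elim (succ #0)) in E. revert E.
      unfold finst, p; simpl. rewrite !fsub_on_diagonal. autorewrite with subst.
      intros E.
      apply on_diagonal_step. rewrite add_succ_r, <- add_succ_l.
      apply (imp_elim E). rewrite add_succ_l, <- add_succ_r.
      apply hyp; now left. }
  apply (all_elim m) in E. unfold finst in E; simpl in E.
  rewrite !fsub_on_diagonal in E. autorewrite with subst in E.
  now apply imp_elim.
Qed.

(** The walk along diagonal d ends in (0, d), which is followed by (d + 1, 0). *)
Lemma diagonal_start G (H : list (fm G)) d : H ⊢ on_diagonal d d zero.
Proof.
  assert (E : H ⊢ finst (on_diagonal #0 #0 zero) d).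
  { apply induction_rule; unfold finst; rewrite fsub_on_diagonal;
      autorewrite with subst.
    - apply on_diagonal_iff. rewrite add_zero_r, tri_zero.
      split; [apply fst_zero | apply snd_zero].
    - name_context H'.
      assert (E : H' ⊢ on_diagonal #0 #0 zero) by (apply hyp; now left).
      pose proof (diagonal_walk (H := H') (m := zero) (n := #0)) as W.
      rewrite !add_zero_l in W. specialize (W E).
      apply on_diagonal_iff in W as [W1 W2]. apply on_diagonal_iff.
      rewrite add_zero_r, tri_succ, add_succ_r. split.
      + now rewrite (fst_succ_of_zero W1), W2.
      + apply (snd_succ_of_zero W1). }
  unfold finst in E. rewrite fsub_on_diagonal in E. now autorewrite with subst in E.
Qed.

Lemma fst_pair G (H : list (fm G)) m n : fst (pair m n) ≡[H] m.
Proof. apply (on_diagonal_iff H (add m n) m n), diagonal_walk, diagonal_start. Qed.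
Lemma snd_pair G (H : list (fm G)) m n : snd (pair m n) ≡[H] n.
Proof. apply (on_diagonal_iff H (add m n) m n), diagonal_walk, diagonal_start. Qed.

(** * Coded rationals *)

#[local] Instance qpos_proper G (H : list (fm G)) : Proper (eqv H ==> eqv H) (@qpos G).
Proof. intros q q' E. unfold qpos. now rewrite E. Qed.
#[local] Instance qneg_proper G (H : list (fm G)) : Proper (eqv H ==> eqv H) (@qneg G).
Proof. intros q q' E. unfold qneg. now rewrite E. Qed.
#[local] Instance qden_proper G (H : list (fm G)) : Proper (eqv H ==> eqv H) (@qden G).
Proof. intros q q' E. unfold qden. now rewrite E. Qed.
#[local] Instance qcode_proper G (H : list (fm G)) :
  Proper (eqv H ==> eqv H ==> eqv H ==> eqv H) (@qcode G).
Proof. intros a a' E b b' F c c' K. unfold qcode. now rewrite E, F, K. Qed.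
#[local] Instance qfrac_proper G (H : list (fm G)) :
  Proper (eqv H ==> eqv H ==> eqv H) (@qfrac G).
Proof. intros a a' E b b' F. unfold qfrac. now rewrite E, F. Qed.
#[local] Instance qadd_proper G (H : list (fm G)) :
  Proper (eqv H ==> eqv H ==> eqv H) (@qadd G).
Proof. intros q q' E r r' F. unfold qadd. now rewrite E, F. Qed.
#[local] Instance qopp_proper G (H : list (fm G)) : Proper (eqv H ==> eqv H) (@qopp G).
Proof. intros q q' E. unfold qopp. now rewrite E. Qed.
#[local] Instance qsub_proper G (H : list (fm G)) :
  Proper (eqv H ==> eqv H ==> eqv H) (@qsub G).
Proof. intros q q' E r r' F. unfold qsub. now rewrite E, F. Qed.
#[local] Instance qabs_proper G (H : list (fm G)) : Proper (eqv H ==> eqv H) (@qabs G).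
Proof. intros q q' E. unfold qabs. now rewrite E. Qed.
#[local] Instance qle_proper G (H : list (fm G)) :
  Proper (eqv H ==> eqv H ==> fequiv H) (@qle G).
Proof. intros q q' E r r' F. unfold qle. now rewrite E, F. Qed.
#[local] Instance qlt_proper G (H : list (fm G)) :
  Proper (eqv H ==> eqv H ==> fequiv H) (@qlt G).
Proof. intros q q' E r r' F. unfold qlt, lt. now rewrite E, F. Qed.

(** [q] codes (p - m)/d. The three numbers are determined only up to provable
    equality, so that they may be given in a simplified form. *)
Record denotes G (H : list (fm G)) (q p m d : tm G tO) : Prop := {
  denotes_pos : qpos q ≡[H] p;
  denotes_neg : qneg q ≡[H] m;
  denotes_den : qden q ≡[H] d
}.

#[local] Instance denotes_proper G (H : list (fm G)) :
  Proper (eqv H ==> eqv H ==> eqv H ==> eqv H ==> iff) (denotes H).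
Proof.
  intros q q' E p p' F m m' K d d' L.
  split; intros [P M D]; constructor.
  - now rewrite <- E, P.
  - now rewrite <- E, M.
  - now rewrite <- E, D.
  - now rewrite E, P.
  - now rewrite E, M.
  - now rewrite E, D.
Qed.

Section Rationals.
Context G (H : list (fm G)).
Implicit Types q r p m d a b c k n : tm G tO.

Add Ring rationals_ring : (semiring H)
  (setoid (eqv_equivalence H tO) (semiring_ext H)).

Lemma denotes_self q : denotes H q (qpos q) (qneg q) (qden q).
Proof. constructor; reflexivity. Qed.

Lemma denotes_qcode a b c d : (succ c ≡[H] d) -> denotes H (qcode a b c) a b d.
Proof.
  intros E. constructor; unfold qpos, qneg, qden, qcode.
  - now rewrite !fst_pair.
  - now rewrite fst_pair, snd_pair.
  - now rewrite snd_pair.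
Qed.

Lemma denotes_qadd q r p m d p' m' d' :
  denotes H q p m d -> denotes H r p' m' d' ->
  denotes H (qadd q r) (add (mul p d') (mul p' d)) (add (mul m d') (mul m' d)) (mul d d').
Proof.
  intros [P M D] [P' M' D']. unfold qadd. rewrite <- P, <- M, <- D, <- P', <- M', <- D'.
  apply denotes_qcode. unfold qden. now rewrite mul_succ_r, add_succ_r, pred_succ.
Qed.

Lemma denotes_qsub q r p m d p' m' d' :
  denotes H q p m d -> denotes H r p' m' d' ->
  denotes H (qsub q r) (add (mul p d') (mul m' d)) (add (mul m d') (mul p' d)) (mul d d').
Proof.
  intros V [P' M' D']. apply denotes_qadd; [exact V|].
  unfold qopp. rewrite <- P', <- M', <- D'. now apply denotes_qcode.
Qed.

Lemma denotes_qabs q p m d :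
  denotes H q p m d -> denotes H (qabs q) (absdiff p m) zero d.
Proof.
  intros [P M D]. unfold qabs. rewrite <- P, <- M, <- D. now apply denotes_qcode.
Qed.

Lemma denotes_qfrac a d : (succ (pred d) ≡[H] d) -> denotes H (qfrac a d) a zero d.
Proof. apply denotes_qcode. Qed.

Lemma qle_denotes q r p m d p' m' d' :
  denotes H q p m d -> denotes H r p' m' d' ->
  (H ⊢ qle q r) <->
  (H ⊢ le (add (mul p d') (mul m' d)) (add (mul p' d) (mul m d'))).
Proof. intros [P M D] [P' M' D']. unfold qle. now rewrite P, M, D, P', M', D'. Qed.

Lemma qle_of_qlt q r : (H ⊢ qlt q r) -> H ⊢ qle q r.
Proof.
  unfold qlt, qle, lt.
  rewrite !le_iff. intros [z E]. exists (succ z).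
  now rewrite <- E, add_succ_r, add_succ_l.
Qed.

(** The middle denominator cancels. *)
Lemma qle_trans q r s : (H ⊢ qle q r) -> (H ⊢ qle r s) -> H ⊢ qle q s.
Proof.
  unfold qle. rewrite !le_iff. intros [z E] [w F]. apply le_iff.
  apply le_cancel with (d := snd r) (w := add (mul z (qden s)) (mul w (qden q)))
    (t := add (mul (mul (qneg r) (qden s)) (qden q)) (mul (mul (qpos r) (qden q)) (qden s))).
  change (succ (snd r)) with (qden r).
  transitivity
    (add (mul (add (add (mul (qpos q) (qden r)) (mul (qneg r) (qden q))) z) (qden s))
      (mul (add (add (mul (qpos r) (qden s)) (mul (qneg s) (qden r))) w) (qden q))).
  - ring.
  - rewrite E, F. ring.
Qed.

(** |q - r| <= s *)
Definition close (q r s : tm G tO) : Prop := H ⊢ qle (qabs (qsub q r)) s.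

Lemma close_iff q r s p m d p' m' d' p'' m'' d'' :
  denotes H q p m d -> denotes H r p' m' d' -> denotes H s p'' m'' d'' ->
  close q r s <->
  (H ⊢ le (add (mul (add (mul p d') (mul m' d)) d'') (mul m'' (mul d d')))
          (add (mul p'' (mul d d')) (mul (add (mul m d') (mul p' d)) d''))) /\
  (H ⊢ le (add (mul (add (mul m d') (mul p' d)) d'') (mul m'' (mul d d')))
          (add (mul p'' (mul d d')) (mul (add (mul p d') (mul m' d)) d''))).
Proof.
  intros Vq Vr Vs. unfold close.
  rewrite (qle_denotes (denotes_qabs (denotes_qsub Vq Vr)) Vs).
  rewrite mul_zero_l, add_zero_r. apply absdiff_le.
Qed.
End Rationals.

(** Positivity of a number n takes the form of the equation S(pred n) = n, which is
    what the denominator of [qfrac] requires. *)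
Lemma pos_add G (H : list (fm G)) m n :
  (succ (pred m) ≡[H] m) -> succ (pred (add m n)) ≡[H] add m n.
Proof.
  intros E. transitivity (add (succ (pred m)) n); [|now rewrite E].
  now rewrite <- E, !add_succ_l, !pred_succ.
Qed.

Section Distance.
Context G (H : list (fm G)).
Implicit Types q r p m d a b c k n : tm G tO.

Add Ring distance_ring : (semiring H)
  (setoid (eqv_equivalence H tO) (semiring_ext H)).

(** From a <= b + r and b <= c + s to a <= c + (r + s), for a = (pa - na)/da and so
    on, with denominators cleared; the denominator of b cancels. The other half of
    the triangle inequality is the case with the p's and n's of a, b, c swapped. *)
Lemma triangle_half pa na da pb nb d pc nc dc pr nr dr ps ns ds :
  let db := succ d in
  (H ⊢ le (add (mul (add (mul pa db) (mul nb da)) dr) (mul nr (mul da db)))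
          (add (mul pr (mul da db)) (mul (add (mul na db) (mul pb da)) dr))) ->
  (H ⊢ le (add (mul (add (mul pb dc) (mul nc db)) ds) (mul ns (mul db dc)))
          (add (mul ps (mul db dc)) (mul (add (mul nb dc) (mul pc db)) ds))) ->
  H ⊢ le (add (mul (add (mul pa dc) (mul nc da)) (mul dr ds))
            (mul (add (mul nr ds) (mul ns dr)) (mul da dc)))
         (add (mul (add (mul pr ds) (mul ps dr)) (mul da dc))
            (mul (add (mul na dc) (mul pc da)) (mul dr ds))).
Proof.
  intros db L1 L2. apply le_iff in L1 as [w1 E1]. apply le_iff in L2 as [w2 E2].
  apply le_cancel with (d := d) (t := mul (add nb pb) (mul (mul da dc) (mul dr ds)))
    (w := add (mul w1 (mul dc ds)) (mul w2 (mul da dr))).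
  fold db. eapply transitivity;
    [|eapply transitivity; [apply add_proper; (apply mul_proper; [|reflexivity]);
      [exact E1 | exact E2]|]].
  - instantiate (1 := mul da dr). instantiate (1 := mul dc ds). ring.
  - ring.
Qed.

Lemma close_trans a b c r s : close H a b r -> close H b c s -> close H a c (qadd r s).
Proof.
  rewrite (close_iff (denotes_self H a) (denotes_self H c)
    (denotes_qadd (denotes_self H r) (denotes_self H s))).
  rewrite !(close_iff (denotes_self H _) (denotes_self H _) (denotes_self H _)).
  intros [L1 L2] [M1 M2]. split; eapply triangle_half; eassumption.
Qed.

Lemma close_sym a b r : close H a b r -> close H b a r.
Proof.
  rewrite !(close_iff (denotes_self H _) (denotes_self H _) (denotes_self H _)).
  rewrite (mul_comm H (qden b) (qden a)).
  rewrite (add_comm H (mul (qpos b) (qden a))), (add_comm H (mul (qneg b) (qden a))).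
  tauto.
Qed.

Lemma close_weaken a b r r' : close H a b r -> (H ⊢ qle r r') -> close H a b r'.
Proof. apply qle_trans. Qed.

Lemma pow2_pos n : succ (pred (pow2 n)) ≡[H] pow2 n.
Proof.
  induct n for (succ (pred (pow2 #0))) ≡ (pow2 #0).
  - now rewrite pow2_zero, one_eqv, pred_succ.
  - rewrite pow2_succ. now apply pos_add.
Qed.

Lemma pos_of_lt k : (H ⊢ lt zero k) -> succ (pred k) ≡[H] k.
Proof.
  intros L. apply le_iff in L as [z E]. rewrite <- E.
  now rewrite add_succ_l, pred_succ.
Qed.

(** 3 (1/(3 k) + 2/2^(n+3)) + 2/2^(n+1) <= 1/k + 2/2^n, since the left-hand side is
    1/k + (7/4)/2^n. *)
Lemma error_sum k K n :
  (succ (pred k) ≡[H] k) -> (K ≡[H] add k (add k k)) ->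
  let n1 := succ n in
  let n3 := succ (succ n1) in
  let e := qadd (qfrac one K) (eps2 n3) in
  H ⊢ qle (qadd (eps n1) (qadd e (qadd e (qadd e (eps n1))))) (qadd (qfrac one k) (eps2 n)).
Proof.
  intros Hk HK n1 n3 e.
  assert (H3k : succ (pred K) ≡[H] K) by (rewrite HK; now apply pos_add).
  pose proof (denotes_qadd (denotes_qfrac one H3k) (denotes_qfrac two (pow2_pos n3))) as Ve.
  pose proof (denotes_qfrac one (pow2_pos n1)) as V1.
  pose proof (denotes_qadd V1 (denotes_qadd Ve (denotes_qadd Ve (denotes_qadd Ve V1)))) as VL.
  pose proof (denotes_qadd (denotes_qfrac one Hk) (denotes_qfrac two (pow2_pos n))) as VR.
  apply (qle_denotes VL VR). apply le_iff.
  set (p := pow2 n).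
  assert (P1 : pow2 n1 ≡[H] add p p) by apply pow2_succ.
  assert (P3 : pow2 n3 ≡[H] mul (add one (add one (add one one))) (add p p)).
  { unfold n3. rewrite pow2_succ, pow2_succ, P1. ring. }
  pose (d := mul (add k (add k k)) (mul (add one (add one (add one one))) (add p p))).
  (* The slack 1/(4 p), times the denominators (2 p) (2 p) d^3 and k p of the two
     sides. *)
  exists (mul (mul p (mul k p)) (mul d (mul d d))).
  rewrite HK, P1, P3, two_eqv, succ_add. unfold d. ring.
Qed.
End Distance.

(** * Reals *)

Lemma tsub_qadd G D (H : list (fm D)) (s : sub G D) q r :
  tsub s (qadd q r) ≡[H] qadd (tsub s q) (tsub s r).
Proof. unfold qadd. now autorewrite with subst. Qed.

Lemma tsub_qsub G D (H : list (fm D)) (s : sub G D) q r :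
  tsub s (qsub q r) ≡[H] qsub (tsub s q) (tsub s r).
Proof. unfold qsub. now rewrite tsub_qadd, tsub_qopp. Qed.

Lemma rinv_app G (H : list (fm G)) k n : rinv k · n ≡[H] qfrac one k.
Proof. apply Pi_eqv. Qed.

Lemma rdist_app G (H : list (fm G)) x y n :
  rdist x y · n ≡[H] qabs (qsub (x · succ n) (y · succ n)).
Proof.
  unfold rdist, rabs, rsub. rewrite beta, tsub_qabs, tsub_app, tsub_scons_wk, tsub_var.
  rewrite tsub_Var, scons_vz, beta, tsub_qsub. now autorewrite with subst.
Qed.

(** The two instantiations are composed into one substitution [s]: provable
    equality could not be used between them, since the intermediate formula still
    has a bound variable. *)
Lemma is_real_elim G (H : list (fm G)) x i j :
  (H ⊢ is_real x) -> H ⊢ qlt (qabs (qsub (x · i) (x · add i j))) (eps i).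
Proof.
  intros R. apply (all_elim i) in R. unfold finst in R; simpl in R.
  apply (all_elim j) in R. unfold finst, qlt in R. rewrite !fsub_lt, !tsub_tsub in R.
  set (s := fun (a : ty) (z : var (tO :: tO :: G) a) => _) in R.
  assert (X : tsub s (↑↑x) = x) by (rewrite !tsub_wk; apply tsub_var).
  assert (I : tsub s (#1) = i).
  { unfold s. rewrite tsub_Var, up_vs, tsub_scons_wk. apply tsub_var. }
  assert (J : tsub s (#0) = j) by reflexivity.
  rewrite tsub_Var in I, J. clearbody s. unfold lt in R. autorewrite with subst in R.
  rewrite !tsub_qsub in R. autorewrite with subst in R. now rewrite X, I, J in R.
Qed.

Lemma rle_elim G (H : list (fm G)) x y n :
  (H ⊢ rle x y) -> H ⊢ qle (x · n) (qadd (y · n) (eps2 n)).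
Proof.
  intros L. apply (all_elim n) in L. unfold finst, qle in L. rewrite fsub_le in L.
  autorewrite with subst in L. rewrite !tsub_qadd in L. now autorewrite with subst in L.
Qed.

Lemma rle_intro G (H : list (fm G)) x y :
  (map fwk H ⊢ qle (↑x · #0) (qadd (↑y · #0) (eps2 #0))) -> H ⊢ rle x y.
Proof. apply all_intro. Qed.

Lemma rle_rdist_elim G (H : list (fm G)) x y k n :
  (H ⊢ rle (rdist x y) (rinv k)) ->
  close H (x · succ n) (y · succ n) (qadd (qfrac one k) (eps2 n)).
Proof.
  intros L. apply (rle_elim n) in L. now rewrite rdist_app, rinv_app in L.
Qed.

Section RenamingRationals.
Context G D (s : sub G D) (R : is_ren s).
Hint Resolve R : ren.

Lemma tsub_qadd_ren q r : tsub s (qadd q r) = qadd (tsub s q) (tsub s r).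
Proof.
  unfold qadd. rewrite tsub_qcode, !tsub_add, tsub_pred.
  now rewrite !tsub_mul_ren, !tsub_qpos, !tsub_qneg, !tsub_qden.
Qed.
Lemma tsub_qsub_ren q r : tsub s (qsub q r) = qsub (tsub s q) (tsub s r).
Proof. unfold qsub. now rewrite tsub_qadd_ren, tsub_qopp. Qed.
Lemma fsub_qle q r : fsub s (qle q r) = qle (tsub s q) (tsub s r).
Proof.
  unfold qle. rewrite fsub_le, !tsub_add.
  now rewrite !tsub_mul_ren, !tsub_qpos, !tsub_qneg, !tsub_qden.
Qed.
Lemma fsub_qlt q r : fsub s (qlt q r) = qlt (tsub s q) (tsub s r).
Proof.
  unfold qlt. rewrite fsub_lt, !tsub_add.
  now rewrite !tsub_mul_ren, !tsub_qpos, !tsub_qneg, !tsub_qden.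
Qed.
End RenamingRationals.

Section RenamingReals.
Context G D (s : sub G D) (R : is_ren s).
Hint Resolve R : ren.

Lemma tsub_rdist x y : tsub s (rdist x y) = rdist (tsub s x) (tsub s y).
Proof.
  unfold rdist, rabs. rewrite tsub_lam_ren, tsub_qabs, tsub_app, tsub_up_wk by auto with ren.
  unfold rsub. rewrite tsub_lam_ren, tsub_qsub_ren by auto with ren.
  now rewrite !tsub_app, !tsub_up_wk.
Qed.
Lemma fsub_rle x y : fsub s (rle x y) = rle (tsub s x) (tsub s y).
Proof.
  unfold rle; simpl. rewrite fsub_qle, tsub_qadd_ren by auto with ren.
  now rewrite tsub_eps2, !tsub_app, !tsub_up_wk.
Qed.
Lemma fsub_req x y : fsub s (req x y) = req (tsub s x) (tsub s y).
Proof.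
  unfold req; simpl. rewrite fsub_qle, tsub_qabs, tsub_qsub_ren by auto with ren.
  now rewrite tsub_eps2, !tsub_app, !tsub_up_wk.
Qed.
Lemma fsub_rlt x y : fsub s (rlt x y) = rlt (tsub s x) (tsub s y).
Proof.
  unfold rlt; simpl. rewrite fsub_qlt, tsub_qadd_ren by auto with ren.
  now rewrite tsub_eps2, !tsub_app, !tsub_up_wk.
Qed.
Lemma fsub_is_real x : fsub s (is_real x) = is_real (tsub s x).
Proof.
  unfold is_real; simpl. rewrite fsub_qlt, tsub_qabs, tsub_qsub_ren by auto with ren.
  now rewrite !tsub_app, tsub_add, tsub_eps, !tsub_up_wk.
Qed.
End RenamingReals.

Lemma rlt_intro G (H : list (fm G)) x y (n : var G tO) :
  (H ⊢ qlt (qadd (x · Var n) (eps2 (Var n))) (y · Var n)) -> H ⊢ rlt x y.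
Proof.
  intros L. apply (ex_intro_at (t := Var n)). unfold finst.
  rewrite fsub_qlt, tsub_qadd_ren by auto with ren. now autorewrite with subst.
Qed.

Lemma rlt_rinv_eqv G (H : list (fm G)) x m m' :
  (m ≡[H] m') -> (H ⊢ rlt x (rinv m)) -> H ⊢ rlt x (rinv m').
Proof.
  intros E L. restrict_to [m =0 m'; rlt x (rinv m)]%fm.
  eapply ex_elim; [apply hyp; right; now left|].
  unfold fwk at 2. rewrite fsub_rlt, tsub_rinv, !tsub_shift by auto with ren.
  name_context H'.
  assert (E : ↑m ≡[H'] ↑m').
  { apply hyp. right; left. apply (fwk_eqty tO m m'). }
  apply rlt_intro with (n := vz). rewrite rinv_app, <- E, <- (rinv_app _ _ #0).
  apply hyp. now left.
Qed.

Global Opaque qadd qsub qopp qabs qfrac eps eps2 qle qlt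
  rconst rinv rdist is_real req rle rlt.

Lemma fwk_eq0 G a m n : fwk (G := G) (a := a) (m =0 n) = (↑m =0 ↑n)%fm.
Proof. apply (fwk_eqty a m n). Qed.
Lemma fwk_lt G a m n : fwk (G := G) (a := a) (lt m n) = lt (↑m) (↑n).
Proof. unfold fwk. now rewrite fsub_lt, !tsub_shift. Qed.
Lemma fwk_rle G a x y : fwk (G := G) (a := a) (rle x y) = rle (↑x) (↑y).
Proof. unfold fwk. rewrite fsub_rle by auto with ren. now rewrite !tsub_shift. Qed.
Lemma fwk_rlt G a x y : fwk (G := G) (a := a) (rlt x y) = rlt (↑x) (↑y).
Proof. unfold fwk. rewrite fsub_rlt by auto with ren. now rewrite !tsub_shift. Qed.
Lemma fwk_is_real G a x : fwk (G := G) (a := a) (is_real x) = is_real (↑x).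
Proof. unfold fwk. rewrite fsub_is_real by auto with ren. now rewrite !tsub_shift. Qed.
Lemma wk_rdist G a x y : wk (G := G) (a := a) (rdist x y) = rdist (↑x) (↑y).
Proof. rewrite <- tsub_shift, tsub_rdist by auto with ren. now rewrite !tsub_shift. Qed.
Lemma wk_rinv G a k : wk (G := G) (a := a) (rinv k) = rinv (↑k).
Proof. rewrite <- tsub_shift, tsub_rinv. now rewrite !tsub_shift. Qed.
Lemma wk_add G a m n : wk (G := G) (a := a) (add m n) = add (↑m) (↑n).
Proof. rewrite <- tsub_shift, tsub_add. now rewrite !tsub_shift. Qed.
#[local] Hint Rewrite fwk_eq0 fwk_lt fwk_rle fwk_rlt fwk_is_real wk_rdist wk_rinv
  wk_add wk_app wk_zero wk_Var : fwk.

(** From x to y by way of x' and y'. Reals are compared at a shifted index, so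
    the inequalities at index m = n + 3 concern approximations number n + 4. *)
Section Chain.
Context G (H : list (fm G)) (x x' y y' : tm G t1) (k K : tm G tO).
Hypothesis Hk : H ⊢ lt zero k.
Hypothesis HK : K ≡[H] add k (add k k).
Hypothesis Rx : H ⊢ is_real x.
Hypothesis Ry : H ⊢ is_real y.
Hypothesis Hx : H ⊢ rle (rdist x' x) (rinv K).
Hypothesis Hy : H ⊢ rle (rdist y' y) (rinv K).
Hypothesis Hxy : H ⊢ rle (rdist x' y') (rinv K).

Lemma close_of_real z n : (H ⊢ is_real z) ->
  close H (z · succ n) (z · succ (succ (succ (succ n)))) (eps (succ n)).
Proof.
  intros R. pose proof (is_real_elim (succ n) (succ (succ (succ zero))) R) as E.
  apply qle_of_qlt in E. now rewrite !add_succ_r, add_zero_r in E.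
Qed.

Lemma dist_chain_at n :
  close H (x · succ n) (y · succ n) (qadd (qfrac one k) (eps2 n)).
Proof.
  eapply close_weaken; [|exact (error_sum n (pos_of_lt Hk) HK)].
  set (m := succ (succ (succ n))).
  eapply close_trans; [now apply close_of_real|].
  eapply close_trans; [exact (close_sym (rle_rdist_elim m Hx))|].
  eapply close_trans; [exact (rle_rdist_elim m Hxy)|].
  eapply close_trans; [exact (rle_rdist_elim m Hy)|].
  now apply close_sym, close_of_real.
Qed.
End Chain.

Lemma dist_chain G (H : list (fm G)) x x' y y' k K :
  (H ⊢ lt zero k) -> (K ≡[H] add k (add k k)) ->
  (H ⊢ is_real x) -> (H ⊢ is_real y) ->
  (H ⊢ rle (rdist x' x) (rinv K)) -> (H ⊢ rle (rdist y' y) (rinv K)) ->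
  (H ⊢ rle (rdist x' y') (rinv K)) ->
  H ⊢ rle (rdist x y) (rinv k).
Proof.
  intros Hk HK Rx Ry Hx Hy Hxy.
  restrict_to [lt zero k; K =0 add k (add k k); is_real x; is_real y;
    rle (rdist x' x) (rinv K); rle (rdist y' y) (rinv K); rle (rdist x' y') (rinv K)]%fm.
  apply rle_intro. simpl map. autorewrite with fwk.
  name_context H'.
  rewrite rdist_app, rinv_app.
  apply dist_chain_at with (x' := ↑x') (y' := ↑y') (K := ↑K); by_hyp.
Qed.

(** * Functions on the unit interval *)

#[local] Notation I := unit_interval.

Section RenamingFunctions.
Context G D (s : sub G D) (R : is_ren s).
Hint Resolve R : ren.

Lemma fsub_unit_interval x : fsub s (I x) = I (tsub s x).
Proof.
  unfold I; simpl. rewrite fsub_is_real, !fsub_rle by auto with ren.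
  now rewrite !tsub_rconst, !tsub_qfrac, !tsub_zero, tsub_one.
Qed.
End RenamingFunctions.

Lemma unit_interval_real G (H : list (fm G)) x : (H ⊢ I x) -> H ⊢ is_real x.
Proof. apply and_left. Qed.

Global Opaque unit_interval.

Section RenamingFunctions.
Context G D (s : sub G D) (R : is_ren s).
Hint Resolve R : ren.

Lemma fsub_is_fun f : fsub s (is_fun f) = is_fun (tsub s f).
Proof.
  unfold is_fun; simpl. rewrite !fsub_is_real, !fsub_req by auto with ren.
  now autorewrite with subst.
Qed.
Lemma fsub_cont_within f m k :
  fsub s (cont_within f m k I) = cont_within (tsub s f) (tsub s m) (tsub s k) I.
Proof.
  unfold cont_within; simpl.
  rewrite !fsub_unit_interval, fsub_rlt, fsub_rle, !tsub_rdist by auto with ren.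
  now autorewrite with subst.
Qed.
Lemma fsub_conv_within fs f m k :
  fsub s (conv_within fs f m k I)
  = conv_within (tsub s fs) (tsub s f) (tsub s m) (tsub s k) I.
Proof.
  unfold conv_within; simpl.
  rewrite !fsub_unit_interval, fsub_le, fsub_rle, !tsub_rdist by auto with ren.
  now autorewrite with subst.
Qed.
End RenamingFunctions.

Section FunctionElimination.
Context G (H : list (fm G)).

Lemma is_fun_elim f (x : var G t1) :
  (H ⊢ is_fun f) -> (H ⊢ is_real (Var x)) -> H ⊢ is_real (f · Var x).
Proof.
  intros F Rx. apply and_left, (all_elim (Var x)) in F. unfold finst in F; simpl in F.
  rewrite !fsub_is_real in F by auto with ren. autorewrite with subst in F.
  exact (imp_elim F Rx).
Qed.

Lemma cont_within_elim f m k (x y : var G t1) :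
  (H ⊢ cont_within f m k I) -> (H ⊢ I (Var x)) -> (H ⊢ I (Var y)) ->
  (H ⊢ rlt (rdist (Var x) (Var y)) (rinv m)) ->
  H ⊢ rle (rdist (f · Var x) (f · Var y)) (rinv k).
Proof.
  intros F Ix Iy L. apply (all_elim (Var x)) in F. unfold finst in F; simpl in F.
  apply (all_elim (Var y)) in F. unfold finst in F; simpl in F.
  rewrite !fsub_unit_interval, !fsub_rlt, !fsub_rle, !tsub_rdist in F by auto with ren.
  autorewrite with subst in F.
  exact (imp_elim (imp_elim (imp_elim F Ix) Iy) L).
Qed.

Lemma cont_within_intro f m k :
  (rlt (rdist #1 #0) (rinv ↑↑m) :: I #0 :: I #1 :: map fwk (map fwk H)
     ⊢ rle (rdist (↑↑f · #1) (↑↑f · #0)) (rinv ↑↑k)) ->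
  H ⊢ cont_within f m k I.
Proof.
  intros L. apply all_intro, all_intro. now do 3 apply imp_intro.
Qed.

Lemma conv_within_elim fs f m k (x : var G t1) (n : var G tO) :
  (H ⊢ conv_within fs f m k I) -> (H ⊢ I (Var x)) -> (H ⊢ le m (Var n)) ->
  H ⊢ rle (rdist (fs · Var n · Var x) (f · Var x)) (rinv k).
Proof.
  intros F Ix L. apply (all_elim (Var x)) in F. unfold finst in F; simpl in F.
  rewrite fsub_unit_interval in F by auto with ren.
  apply (fun F => imp_elim F Ix), (all_elim (Var n)) in F. unfold finst in F; simpl in F.
  rewrite !fsub_le, !fsub_rle, !tsub_rdist in F by auto with ren.
  autorewrite with subst in F.
  exact (imp_elim F L).
Qed.
End FunctionElimination.

Global Opaque is_fun cont_within conv_within.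

Section RenamingModuli.
Context G D (s : sub G D) (R : is_ren s).
Hint Resolve R : ren.

Lemma fsub_C f g : fsub s (C f g I) = C (tsub s f) (tsub s g) I.
Proof.
  unfold C; simpl. rewrite fsub_cont_within, !fsub_lt by auto with ren.
  now autorewrite with subst.
Qed.
Lemma fsub_D fs f h : fsub s (Defs.D fs f h I) = Defs.D (tsub s fs) (tsub s f) (tsub s h) I.
Proof.
  unfold Defs.D; simpl. rewrite fsub_conv_within, !fsub_lt by auto with ren.
  now autorewrite with subst.
Qed.
End RenamingModuli.

Section ModulusElimination.
Context G (H : list (fm G)).

Lemma C_elim f g (k : var G tO) :
  (H ⊢ C f g I) -> (H ⊢ lt zero (Var k)) ->
  H ⊢ lt zero (g · Var k) ∧ cont_within f (g · Var k) (Var k) I.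
Proof.
  intros F Hk. apply (all_elim (Var k)) in F. unfold finst in F; simpl in F.
  rewrite !fsub_cont_within, !fsub_lt in F by auto with ren.
  autorewrite with subst in F.
  exact (imp_elim F Hk).
Qed.

Lemma C_intro f g :
  (lt zero #0 :: map fwk H ⊢ lt zero (↑g · #0) ∧ cont_within (↑f) (↑g · #0) #0 I) ->
  H ⊢ C f g I.
Proof. intros L. now apply all_intro, imp_intro. Qed.

Lemma D_elim fs f h (k : var G tO) :
  (H ⊢ D fs f h I) -> (H ⊢ lt zero (Var k)) ->
  H ⊢ conv_within fs f (h · Var k) (Var k) I.
Proof.
  intros F Hk. apply (all_elim (Var k)) in F. unfold finst in F; simpl in F.
  rewrite !fsub_conv_within, !fsub_lt in F by auto with ren.
  autorewrite with subst in F.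
  exact (imp_elim F Hk).
Qed.
End ModulusElimination.

Global Opaque C D.

Lemma fwk_unit_interval G a x : fwk (G := G) (a := a) (I x) = I (↑x).
Proof.
  unfold fwk. rewrite fsub_unit_interval by auto with ren. now rewrite !tsub_shift.
Qed.
Lemma fwk_is_fun G a f : fwk (G := G) (a := a) (is_fun f) = is_fun (↑f).
Proof. unfold fwk. rewrite fsub_is_fun by auto with ren. now rewrite !tsub_shift. Qed.
Lemma fwk_cont_within G a f m k :
  fwk (G := G) (a := a) (cont_within f m k I) = cont_within (↑f) (↑m) (↑k) I.
Proof. unfold fwk. rewrite fsub_cont_within by auto with ren. now rewrite !tsub_shift. Qed.
Lemma fwk_conv_within G a fs f m k :
  fwk (G := G) (a := a) (conv_within fs f m k I) = conv_within (↑fs) (↑f) (↑m) (↑k) I.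
Proof. unfold fwk. rewrite fsub_conv_within by auto with ren. now rewrite !tsub_shift. Qed.
Lemma fwk_le G a m n : fwk (G := G) (a := a) (le m n) = le (↑m) (↑n).
Proof. unfold fwk. now rewrite fsub_le, !tsub_shift. Qed.
Lemma fwk_C G a f g : fwk (G := G) (a := a) (C f g I) = C (↑f) (↑g) I.
Proof. unfold fwk. rewrite fsub_C by auto with ren. now rewrite !tsub_shift. Qed.
Lemma fwk_D G a fs f h : fwk (G := G) (a := a) (D fs f h I) = D (↑fs) (↑f) (↑h) I.
Proof. unfold fwk. rewrite fsub_D by auto with ren. now rewrite !tsub_shift. Qed.
Lemma fwk_and G a p q : fwk (G := G) (a := a) (p ∧ q) = (fwk p ∧ fwk q)%fm.
Proof. reflexivity. Qed.
#[local] Hint Rewrite fwk_le fwk_conv_within fwk_unit_interval fwk_is_fun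
  fwk_cont_within fwk_C fwk_D fwk_and : fwk.

(** * The modulus *)

(** An instance of a formula at a compound term is in general not literally the
    formula for that term, but an instance at a variable is. Naming a number by
    a fresh variable therefore precedes instantiation. *)
Lemma name_number G (H : list (fm G)) (t : tm G tO) p :
  ((#0 =0 ↑t)%fm :: map fwk H ⊢ fwk p) -> H ⊢ p.
Proof.
  apply ex_elim. apply (ex_intro_at (t := t)). unfold finst; simpl.
  rewrite tsub_scons_wk, tsub_var. apply (eqv_equivalence H tO).
Qed.

Lemma lt_of_pos G (H : list (fm G)) k : (succ (pred k) ≡[H] k) -> H ⊢ lt zero k.
Proof.
  intros E. apply le_iff. exists (pred k).
  now rewrite <- E at 2; rewrite add_succ_l, add_zero_l.
Qed.

(** The three-step estimate. [N] is a variable because [conv_within] is instantiated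
    at it, and [c] is a modulus of f_N at K, which becomes one of f at k. *)
Lemma limit_cont_within G (H : list (fm G)) f fs k K (N : var G tO) m c :
  (H ⊢ lt zero k) -> (K ≡[H] add k (add k k)) -> (H ⊢ is_fun f) ->
  (H ⊢ conv_within fs f m K I) -> (H ⊢ le m (Var N)) ->
  (H ⊢ cont_within (fs · Var N) c K I) ->
  H ⊢ cont_within f c k I.
Proof.
  intros Hk HK Hf Hconv Hm Hcont.
  restrict_to [lt zero k; K =0 add k (add k k); is_fun f; conv_within fs f m K I;
    le m (Var N); cont_within (fs · Var N) c K I]%fm.
  apply cont_within_intro. simpl map. autorewrite with fwk.
  name_context H'.
  assert (Hf : H' ⊢ is_fun ↑↑f) by by_hyp.
  assert (Ix : H' ⊢ I #1) by by_hyp.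
  assert (Iy : H' ⊢ I #0) by by_hyp.
  assert (Hconv : H' ⊢ conv_within ↑↑fs ↑↑f ↑↑m ↑↑K I) by by_hyp.
  assert (Hm : H' ⊢ le ↑↑m (Var (vs (vs N)))) by by_hyp.
  apply dist_chain with (K := ↑↑K) (x' := ↑↑fs · Var (vs (vs N)) · #1)
    (y' := ↑↑fs · Var (vs (vs N)) · #0).
  - by_hyp.
  - by_hyp.
  - apply is_fun_elim; auto using unit_interval_real.
  - apply is_fun_elim; auto using unit_interval_real.
  - now apply (conv_within_elim Hconv).
  - now apply (conv_within_elim Hconv).
  - eapply cont_within_elim; [|exact Ix|exact Iy|apply hyp; now left].
    by_hyp.
Qed.

Lemma cont_within_eqv G (H : list (fm G)) f m m' k :
  (m ≡[H] m') -> (H ⊢ cont_within f m k I) -> H ⊢ cont_within f m' k I.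
Proof.
  intros E F.
  restrict_to [m =0 m'; cont_within f m k I]%fm.
  apply cont_within_intro. simpl map. autorewrite with fwk.
  name_context H'.
  eapply cont_within_elim.
  - by_hyp.
  - by_hyp.
  - by_hyp.
  - apply rlt_rinv_eqv with (m := ↑↑m'); [|apply hyp; now left].
    symmetry. by_hyp.
Qed.

Lemma C_instance G (H : list (fm G)) fs g (N : var G tO) :
  (H ⊢ ∀[tO] C (↑fs · #0) (↑g · #0) I) -> H ⊢ C (fs · Var N) (g · Var N) I.
Proof.
  intros F. apply (all_elim (Var N)) in F. unfold finst in F.
  rewrite fsub_C in F by auto with ren. now autorewrite with subst in F.
Qed.

Lemma fwk_all_C G a fs g :
  fwk (G := G) (a := a) (∀[tO] C (↑fs · #0) (↑g · #0) I)
  = (∀[tO] C (↑(wk (a := a) fs) · #0) (↑(wk (a := a) g) · #0) I)%fm.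
Proof.
  unfold fwk; simpl. rewrite fsub_C by auto with ren. now autorewrite with subst.
Qed.

Lemma limit_modulus_named G (H : list (fm G)) f fs g h k (K N : var G tO) :
  (H ⊢ lt zero k) -> (Var K ≡[H] add k (add k k)) -> (Var N ≡[H] h · Var K) ->
  (H ⊢ is_fun f) -> (H ⊢ ∀[tO] C (↑fs · #0) (↑g · #0) I) -> (H ⊢ D fs f h I) ->
  H ⊢ lt zero (g · Var N · Var K) ∧ cont_within f (g · Var N · Var K) k I.
Proof.
  intros Hk EK EN Hf HC HD.
  assert (HK : H ⊢ lt zero (Var K)).
  { rewrite EK. apply lt_of_pos, pos_add, pos_of_lt, Hk. }
  pose proof (C_elim (C_instance N HC) HK) as HN.
  apply and_intro; [exact (and_left HN)|].
  apply limit_cont_within with (fs := fs) (K := Var K) (N := N) (m := h · Var K).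
  - exact Hk.
  - exact EK.
  - exact Hf.
  - now apply D_elim.
  - apply le_iff. exists zero. now rewrite add_zero_r, EN.
  - exact (and_right HN).
Qed.

Definition modulus : closed_term ((tO ⇒ t1) ⇒ t1 ⇒ t1) :=
  lam (lam (lam (let K := add #0 (add #0 #0) in #2 · (#1 · K) · K))).

(** Stated for instances of [modulus] because its weakenings are such. *)
Lemma modulus_eqv G (H : list (fm G)) (s : sub nil G) g h k :
  tsub s modulus · g · h · k ≡[H]
    g · (h · add k (add k k)) · add k (add k k).
Proof.
  unfold modulus. cbv zeta. rewrite !beta_sub. now autorewrite with subst.
Qed.

Lemma limit_modulus G (H : list (fm G)) f fs g h k M :
  (H ⊢ lt zero k) -> (M ≡[H] g · (h · add k (add k k)) · add k (add k k)) ->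
  (H ⊢ is_fun f) -> (H ⊢ ∀[tO] C (↑fs · #0) (↑g · #0) I) -> (H ⊢ D fs f h I) ->
  H ⊢ lt zero M ∧ cont_within f M k I.
Proof.
  intros Hk HM Hf HC HD.
  restrict_to [lt zero k; M =0 g · (h · add k (add k k)) · add k (add k k); is_fun f;
    (∀[tO] C (↑fs · #0) (↑g · #0) I); D fs f h I]%fm.
  apply (name_number (t := add k (add k k))).
  apply (name_number (t := ↑h · #0)).
  simpl map. autorewrite with fwk. rewrite !fwk_all_C.
  name_context H'.
  assert (EK : #1 ≡[H'] add (↑↑k) (add (↑↑k) (↑↑k))) by by_hyp.
  assert (EN : #0 ≡[H'] ↑↑h · #1) by by_hyp.
  assert (EM : ↑↑M ≡[H'] ↑↑g · #0 · #1).
  { rewrite EN, EK. by_hyp. }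
  assert (L : H' ⊢ lt zero (↑↑g · #0 · #1)
                  ∧ cont_within (↑↑f) (↑↑g · #0 · #1) (↑↑k) I).
  { apply limit_modulus_named with (fs := ↑↑fs) (h := ↑↑h);
      try assumption; by_hyp. }
  apply and_intro.
  - rewrite EM. exact (and_left L).
  - apply (cont_within_eqv (symmetry EM)). exact (and_right L).
Qed.

Lemma limit_C G (H : list (fm G)) f fs g h (s : sub nil G) :
  (H ⊢ is_fun f) -> (H ⊢ ∀[tO] C (↑fs · #0) (↑g · #0) I) -> (H ⊢ D fs f h I) ->
  H ⊢ C f (tsub s modulus · g · h) I.
Proof.
  intros Hf HC HD.
  restrict_to [is_fun f; (∀[tO] C (↑fs · #0) (↑g · #0) I); D fs f h I]%fm.
  apply C_intro. simpl map. autorewrite with fwk. rewrite fwk_all_C.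
  name_context H'.
  apply limit_modulus with (fs := ↑fs) (g := ↑g) (h := ↑h).
  - apply hyp; now left.
  - rewrite wk_tsub. apply modulus_eqv.
  - by_hyp.
  - by_hyp.
  - by_hyp.
Qed.

Theorem theorem4p3 (d : proof_of ULC) :
  {t : closed_term ((tO ⇒ t1) ⇒ t1 ⇒ t1) | provable (ULC_ef t)}.
Proof.
  exists modulus. change (nil ⊢ ULC_ef modulus). unfold ULC_ef.
  do 4 apply all_intro. do 3 apply imp_intro.
  pose (G := [t1; tO ⇒ t1; tO ⇒ t1 ⇒ t1; t1 ⇒ t1]%ty).
  rewrite <- !tsub_shift, !tsub_tsub.
  apply limit_C with (fs := (#2 : tm G (tO ⇒ t1 ⇒ t1))).
  - apply hyp. simpl; auto.
  - eapply and_left, hyp. now left.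
  - eapply and_right, hyp. now left.
Qed.
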